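(* Let $0<q<1$ and let $f(x)=\sum_{n\ge0}\frac{q^{n(n-1)/2}}{n!}x^n$. Let $h$ be the function on $\tilde{\mathbb{C}}^*$ given by $$h(x)=\frac{\sqrt{\kappa}}{2\pi i}\int_{\mathcal{C}}e^{\,t-\frac{1}{2\ln q}\log^2\frac{\sqrt q\,t}{x}}\,\frac{dt}{t}.$$ Then for all non-zero complex numbers $x$, $$f(x)=\sum_{n\in\mathbb{Z}}h(xe^{2n\pi i}),$$ where the series on the right-hand side converges uniformly on any compact subset of $\mathbb{C}^*$.
   Context: $\kappa=-\frac{2\pi}{\ln q}>0$. $\tilde{\mathbb{C}}^*$ is the Riemann surface of the logarithm, and a non-zero complex number $x$ is lifted to $\tilde{\mathbb{C}}^*$ by a choice of argument (the bilateral sum does not depend on the choice). $\mathcal{C}$ is a Hankel contour: a smooth contour in the $t$-plane that starts at infinity on the negative real axis, encircles the origin once in the positive direction, and returns to negative infinity; along it $\arg t$ goes from $-\pi$ to $\pi$, and $\log\frac{\sqrt q\,t}{x}=\log t+\frac12\ln q-\log x$. *)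

(* Defs.v *)
From Stdlib Require Import Reals ZArith List Lra.
From Coquelicot Require Import Coquelicot.
Open Scope R_scope.

Definition Cexp (z : C) : C := (exp (Re z) * cos (Im z), exp (Re z) * sin (Im z)).

(* The Riemann surface of the logarithm: a modulus > 0 together with an
   argument in R that is not reduced modulo 2 PI. *)
Record Clog_surface : Type := mkClog {
  lmod : R;
  larg : R;
  lmod_pos : 0 < lmod
}.

Definition proj (X : Clog_surface) : C :=
  (lmod X * cos (larg X), lmod X * sin (larg X)).

Definition llog (X : Clog_surface) : C := (ln (lmod X), larg X).

(* X e^{2 n pi i} *)
Definition turn (n : Z) (X : Clog_surface) : Clog_surface :=
  mkClog (lmod X) (larg X + 2 * IZR n * PI) (lmod_pos X).

Definition kappa (q : R) : R := - (2 * PI / ln q).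

Definition CSeries (a : nat -> C) : C :=
  (Series (fun n => Re (a n)), Series (fun n => Im (a n))).

Definition f_term (q : R) (x : C) (n : nat) : C :=
  (RtoC (q ^ (n * (n - 1) / 2) / INR (fact n)) * x ^ n)%C.

Definition f_entire (q : R) (x : C) : C := CSeries (f_term q x).

Definition Derive_RC (t : R -> C) (s : R) : C :=
  (Derive (fun u => Re (t u)) s, Derive (fun u => Im (t u)) s).

(* A Hankel contour, as a parametrised curve s |-> t(s), s in R, carried
   together with a continuous determination of arg t (hence a curve in the
   surface). "Starts at infinity on the negative real axis, encircles 0 once
   positively and returns" means that |t| tends to infinity at both ends while
   arg t goes from -PI to PI. Smooth is taken to mean C^1.
   Example: t(s) = (1 + i s)^2 with arg t(s) = 2 atan s. *)
Record Hankel_contour (g : R -> Clog_surface) : Prop := {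
  hankel_derivable_Re : forall s, ex_derive (fun u => Re (proj (g u))) s;
  hankel_derivable_Im : forall s, ex_derive (fun u => Im (proj (g u))) s;
  hankel_C1_Re : forall s, continuous (Derive (fun u => Re (proj (g u)))) s;
  hankel_C1_Im : forall s, continuous (Derive (fun u => Im (proj (g u)))) s;
  hankel_arg_continuous : forall s, continuous (fun u => larg (g u)) s;
  hankel_mod_start : is_lim (fun u => lmod (g u)) m_infty p_infty;
  hankel_mod_end : is_lim (fun u => lmod (g u)) p_infty p_infty;
  hankel_arg_start : is_lim (fun u => larg (g u)) m_infty (- PI);
  hankel_arg_end : is_lim (fun u => larg (g u)) p_infty PI
}.

(* log (sqrt q t / x) = log t + (ln q) / 2 - log x, for T and X above t and x *)
Definition log_ratio (q : R) (T X : Clog_surface) : C :=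
  (llog T + RtoC (ln q / 2) - llog X)%C.

(* The integrand of h pulled back along the contour: dt = t'(s) ds. *)
Definition h_integrand (q : R) (g : R -> Clog_surface) (X : Clog_surface) (s : R) : C :=
  (Cexp (proj (g s) - RtoC (1 / (2 * ln q)) * (log_ratio q (g s) X) ^ 2)
   / proj (g s) * Derive_RC (fun u => proj (g u)) s)%C.

Definition h_hankel (q : R) (g : R -> Clog_surface) (X : Clog_surface) : C :=
  (RtoC (sqrt (kappa q)) / (2 * RtoC PI * Ci)
   * RInt_gen (V := C_R_CompleteNormedModule) (h_integrand q g X)
       (Rbar_locally m_infty) (Rbar_locally p_infty))%C.

(* a(-M) + ... + a(N) *)
Definition bilateral_partial_sum (a : Z -> C) (M N : nat) : C :=
  sum_n (fun k => a (Z.of_nat k - Z.of_nat M)%Z) (M + N).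

(* The two ends go to infinity independently of each other. *)
Definition is_bilateral_series (a : Z -> C) (l : C) : Prop :=
  filterlim (fun MN : nat * nat => bilateral_partial_sum a (fst MN) (snd MN))
    (filter_prod eventually eventually) (locally l).

Definition bilateral_series_cvg_uniformly_on
    (K : C -> Prop) (u : Z -> C -> C) (l : C -> C) : Prop :=
  forall eps : R, 0 < eps -> exists n0 : nat, forall M N : nat,
    (n0 <= M)%nat -> (n0 <= N)%nat -> forall x : C, K x ->
    Cmod (bilateral_partial_sum (fun n => u n x) M N - l x)%C < eps.

Definition compact_set {T : UniformSpace} (K : T -> Prop) : Prop :=
  forall (I : Type) (U : I -> T -> Prop),
    (forall i, open (U i)) ->
    (forall x, K x -> exists i, U i x) ->
    exists l : list I, forall x, K x -> exists i, In i l /\ U i x.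

(* A choice of argument for the points of K. The arguments chosen must be
   bounded on K (as they are for the principal determination, or any one with
   values in a fixed interval of length 2 PI): the sum of the bilateral series
   does not depend on the choice, but its partial sums do, and a choice
   of unbounded arguments shifts the index n by unbounded amounts. *)
Definition argument_choice_on (K : C -> Prop) (lift : C -> Clog_surface) : Prop :=
  (forall x, K x -> proj (lift x) = x) /\
  (exists A : R, forall x, K x -> Rabs (larg (lift x)) <= A).

(* Main.v *)
Require Import Defs.
From Stdlib Require Import Reals ZArith Lra Lia List.
From Coquelicot Require Import Coquelicot.
Open Scope R_scope.

(** Put [a = - 1 / (2 ln q) > 0], [b = log x - (ln q) / 2] and [t = e^w].  On the
    surface of the logarithm [dt / t = dw], and the integrand of [h] becomes the
    entire function [Phi a b w = exp (e^w + a (w - b)^2)], integrated along a curve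
    whose ends satisfy [Re w -> +oo] and [Im w -> - PI], resp. [Im w -> PI].

    An entire function has a primitive [G] ([primitive_spec]), so the shape and the
    length of the contour do not matter: the integral is the difference of the
    limits of [G] at the two ends.  They exist because [e^w] is close to
    [- e^(Re w)] there, which dominates the quadratic term ([end_value_rate],
    [strip_variation]).  More generally [G] has a limit [T j] at the end
    [+oo + i (2 j + 1) PI] for each integer [j].

    Turning [x] by [n] full turns adds [2 n PI i] to [b].  As [e^w] has period
    [2 PI i], this amounts to translating the contour by [- 2 n PI i], so that
    [h (x e^(2 n PI i)) = c (T (- n) - T (- n - 1))] with
    [c = sqrt kappa / (2 PI i)] ([hankel_integral], [h_hankel_turn]), and the
    bilateral sum telescopes: [h_(-M) + ... + h_N = c (T M - T (- N - 1))]
    ([bilateral_partial_sum_h]).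

    On the horizontal line [Im w = v] the integrand carries the factor
    [exp (- a (v - arg x)^2)].  Hence [T M] and [T (- N - 1)] are exponentially close
    to the limits of [G] at the upper and lower ends of the imaginary axis, at a rate
    that depends only on bounds for [log |x|] and [arg x]
    ([end_value_near_vertical]).  This gives the uniform convergence, and
    identifies the sum as [c] times the integral of [Phi a b] over the imaginary
    axis.

    On that axis [|e^w| = 1], so the series [exp (e^w) = sum_k e^(k w) / k!]
    converges uniformly, and it is integrated term by term against the Gaussian
    factor ([truncation_error_bound]).  Completing the square in
    [k w + a (w - b)^2] ([gauss_complete_square]) and moving the line of integration
    ([gauss_vertical_limit]) turns the [k]-th term into
    [i sqrt (PI / a) x^k q^(k (k - 1) / 2) / k!], and [c i sqrt (PI / a) = 1]. *)

(** * Complex derivatives along curves *)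

(** The derivative of a curve in the plane, taken in coordinates so that the
    one-variable real theory applies to each of them. *)
Definition is_Cderive (c : R -> C) (s : R) (l : C) : Prop :=
  is_derive (fun u => Re (c u)) s (Re l) /\
  is_derive (fun u => Im (c u)) s (Im l).

(** Complex differentiability enters only through the chain rule along curves, so
    the chain rule itself is taken as the definition.  It is stable under composition
    and products, and applied to horizontal and vertical lines it contains the
    Cauchy-Riemann equations. *)
Definition has_Cderivative (F F' : C -> C) : Prop :=
  forall (c : R -> C) (s : R) (l : C),
    is_Cderive c s l -> is_Cderive (fun u => F (c u)) s (F' (c s) * l)%C.

Definition Ccontinuous (F : C -> C) : Prop :=
  forall z : C, continuous (fun w : C => Re (F w)) z /\
                continuous (fun w : C => Im (F w)) z.

Lemma Ceq (z w : C) : Re z = Re w -> Im z = Im w -> z = w.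
Proof. destruct z, w; unfold Re, Im; simpl; intros; subst; reflexivity. Qed.

Lemma is_Cderive_eq (c : R -> C) (s : R) (l l' : C) :
  is_Cderive c s l -> l = l' -> is_Cderive c s l'.
Proof. intros H e; rewrite <- e; exact H. Qed.

Lemma is_Cderive_ext (c d : R -> C) (s : R) (l : C) :
  (forall u, c u = d u) -> is_Cderive c s l -> is_Cderive d s l.
Proof.
intros e [H1 H2]; split.
- refine (is_derive_ext _ _ _ _ _ H1); intros u; simpl; now rewrite e.
- refine (is_derive_ext _ _ _ _ _ H2); intros u; simpl; now rewrite e.
Qed.

Lemma is_derive_eq (f : R -> R) (s l l' : R) :
  is_derive f s l -> l = l' -> is_derive f s l'.
Proof. intros H e; rewrite <- e; exact H. Qed.

Lemma is_Cderive_const (z : C) (s : R) : is_Cderive (fun _ => z) s (RtoC 0).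
Proof. split; exact (is_derive_const _ _). Qed.

Lemma is_Cderive_plus (c d : R -> C) (s : R) (l m : C) :
  is_Cderive c s l -> is_Cderive d s m ->
  is_Cderive (fun u => c u + d u)%C s (l + m)%C.
Proof.
intros [H1 H2] [H3 H4]; split.
- exact (is_derive_plus _ _ _ _ _ H1 H3).
- exact (is_derive_plus _ _ _ _ _ H2 H4).
Qed.

Lemma is_Cderive_minus (c d : R -> C) (s : R) (l m : C) :
  is_Cderive c s l -> is_Cderive d s m ->
  is_Cderive (fun u => c u - d u)%C s (l - m)%C.
Proof.
intros [H1 H2] [H3 H4]; split.
- exact (is_derive_minus _ _ _ _ _ H1 H3).
- exact (is_derive_minus _ _ _ _ _ H2 H4).
Qed.

Lemma is_Cderive_mult (c d : R -> C) (s : R) (l m : C) :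
  is_Cderive c s l -> is_Cderive d s m ->
  is_Cderive (fun u => c u * d u)%C s (l * d s + c s * m)%C.
Proof.
intros [H1 H2] [H3 H4]; split.
- apply is_derive_eq with
    ((Re l * Re (d s) + Re (c s) * Re m) - (Im l * Im (d s) + Im (c s) * Im m)).
  + apply (is_derive_minus (V := R_NormedModule)
             (fun u => Re (c u) * Re (d u)) (fun u => Im (c u) * Im (d u)));
      apply (is_derive_mult (K := R_AbsRing)); trivial; exact Rmult_comm.
  + unfold Re, Im; simpl; ring.
- apply is_derive_eq with
    ((Re l * Im (d s) + Re (c s) * Im m) + (Im l * Re (d s) + Im (c s) * Re m)).
  + apply (is_derive_plus (V := R_NormedModule)
             (fun u => Re (c u) * Im (d u)) (fun u => Im (c u) * Re (d u)));
      apply (is_derive_mult (K := R_AbsRing)); trivial; exact Rmult_comm.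
  + unfold Re, Im; simpl; ring.
Qed.

Lemma is_Cderive_scal (z : C) (c : R -> C) (s : R) (l : C) :
  is_Cderive c s l -> is_Cderive (fun u => z * c u)%C s (z * l)%C.
Proof.
intros H; eapply is_Cderive_eq.
- exact (is_Cderive_mult (fun _ => z) c s _ _ (is_Cderive_const z s) H).
- cbv beta; ring.
Qed.

Lemma is_Cderive_sum_n (c : nat -> R -> C) (l : nat -> C) (s : R) (n : nat) :
  (forall k, is_Cderive (c k) s (l k)) ->
  is_Cderive (fun u => sum_n (fun k => c k u) n) s (sum_n l n).
Proof.
intros H; induction n as [|n IH].
- rewrite sum_O; apply is_Cderive_ext with (c 0%nat); [|apply H].
  intros u; now rewrite sum_O.
- rewrite sum_Sn.
  apply is_Cderive_ext with (fun u => sum_n (fun k => c k u) n + c (S n) u)%C.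
  + intros u; now rewrite sum_Sn.
  + apply is_Cderive_plus; [exact IH|apply H].
Qed.

(** With its companion for the sine, this is the derivative of the complex
    exponential along a curve, in coordinates. *)
Lemma is_derive_exp_cos (x y : R -> R) (s x' y' : R) :
  is_derive x s x' -> is_derive y s y' ->
  is_derive (fun u => exp (x u) * cos (y u)) s
    (exp (x s) * (x' * cos (y s) - y' * sin (y s))).
Proof.
intros H1 H2; assert (D1 := is_derive_unique _ _ _ H1).
assert (D2 := is_derive_unique _ _ _ H2).
assert (E1 : ex_derive x s) by (now exists x').
assert (E2 : ex_derive y s) by (now exists y').
auto_derive; [tauto|].
rewrite (is_derive_unique _ _ _ H1 : Derive (fun u => x u) s = x').
rewrite (is_derive_unique _ _ _ H2 : Derive (fun u => y u) s = y'); ring.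
Qed.

Lemma is_derive_exp_sin (x y : R -> R) (s x' y' : R) :
  is_derive x s x' -> is_derive y s y' ->
  is_derive (fun u => exp (x u) * sin (y u)) s
    (exp (x s) * (x' * sin (y s) + y' * cos (y s))).
Proof.
intros H1 H2.
assert (E1 : ex_derive x s) by (now exists x').
assert (E2 : ex_derive y s) by (now exists y').
auto_derive; [tauto|].
rewrite (is_derive_unique _ _ _ H1 : Derive (fun u => x u) s = x').
rewrite (is_derive_unique _ _ _ H2 : Derive (fun u => y u) s = y'); ring.
Qed.

Lemma has_Cderivative_exp : has_Cderivative Cexp Cexp.
Proof.
intros c s l [H1 H2]; split.
- eapply is_derive_eq; [exact (is_derive_exp_cos _ _ _ _ _ H1 H2)|].
  unfold Cexp, Re, Im; simpl; ring.
- eapply is_derive_eq; [exact (is_derive_exp_sin _ _ _ _ _ H1 H2)|].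
  unfold Cexp, Re, Im; simpl; ring.
Qed.

Lemma has_Cderivative_id : has_Cderivative (fun z => z) (fun _ => RtoC 1).
Proof. intros c s l H; eapply is_Cderive_eq; [exact H|ring]. Qed.

Lemma has_Cderivative_const (z : C) : has_Cderivative (fun _ => z) (fun _ => RtoC 0).
Proof.
intros c s l H; eapply is_Cderive_eq; [apply is_Cderive_const|ring].
Qed.

Lemma has_Cderivative_ext (F F' F'' : C -> C) :
  (forall z, F' z = F'' z) -> has_Cderivative F F' -> has_Cderivative F F''.
Proof. intros e H c s l Hc; rewrite <- e; now apply H. Qed.

Lemma has_Cderivative_plus (F F' H H' : C -> C) :
  has_Cderivative F F' -> has_Cderivative H H' ->
  has_Cderivative (fun z => F z + H z)%C (fun z => F' z + H' z)%C.
Proof.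
intros DF DH c s l Hc; eapply is_Cderive_eq.
- apply is_Cderive_plus; [exact (DF _ _ _ Hc)|exact (DH _ _ _ Hc)].
- ring.
Qed.

Lemma has_Cderivative_minus (F F' H H' : C -> C) :
  has_Cderivative F F' -> has_Cderivative H H' ->
  has_Cderivative (fun z => F z - H z)%C (fun z => F' z - H' z)%C.
Proof.
intros DF DH c s l Hc; eapply is_Cderive_eq.
- apply is_Cderive_minus; [exact (DF _ _ _ Hc)|exact (DH _ _ _ Hc)].
- ring.
Qed.

Lemma has_Cderivative_mult (F F' H H' : C -> C) :
  has_Cderivative F F' -> has_Cderivative H H' ->
  has_Cderivative (fun z => F z * H z)%C (fun z => F' z * H z + F z * H' z)%C.
Proof.
intros DF DH c s l Hc; eapply is_Cderive_eq.
- apply is_Cderive_mult; [exact (DF _ _ _ Hc)|exact (DH _ _ _ Hc)].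
- simpl; ring.
Qed.

Lemma has_Cderivative_comp (F F' H H' : C -> C) :
  has_Cderivative F F' -> has_Cderivative H H' ->
  has_Cderivative (fun z => F (H z)) (fun z => F' (H z) * H' z)%C.
Proof.
intros DF DH c s l Hc; eapply is_Cderive_eq.
- exact (DF (fun u => H (c u)) s _ (DH _ _ _ Hc)).
- simpl; ring.
Qed.

Lemma Ccontinuous_id : Ccontinuous (fun z => z).
Proof. intros [x y]; split; [apply continuous_fst|apply continuous_snd]. Qed.

Lemma Ccontinuous_const (z : C) : Ccontinuous (fun _ => z).
Proof. intros w; split; apply continuous_const. Qed.

Lemma Ccontinuous_plus (F H : C -> C) :
  Ccontinuous F -> Ccontinuous H -> Ccontinuous (fun z => F z + H z)%C.
Proof.
intros CF CH z; destruct (CF z) as [F1 F2]; destruct (CH z) as [H1 H2]; split.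
- exact (continuous_plus _ _ _ F1 H1).
- exact (continuous_plus _ _ _ F2 H2).
Qed.

Lemma Ccontinuous_minus (F H : C -> C) :
  Ccontinuous F -> Ccontinuous H -> Ccontinuous (fun z => F z - H z)%C.
Proof.
intros CF CH z; destruct (CF z) as [F1 F2]; destruct (CH z) as [H1 H2]; split.
- exact (continuous_minus _ _ _ F1 H1).
- exact (continuous_minus _ _ _ F2 H2).
Qed.

Lemma Ccontinuous_mult (F H : C -> C) :
  Ccontinuous F -> Ccontinuous H -> Ccontinuous (fun z => F z * H z)%C.
Proof.
intros CF CH z; destruct (CF z) as [F1 F2]; destruct (CH z) as [H1 H2]; split.
- exact (continuous_minus _ _ _ (continuous_mult (K := R_AbsRing) _ _ _ F1 H1)
                                (continuous_mult (K := R_AbsRing) _ _ _ F2 H2)).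
- exact (continuous_plus _ _ _ (continuous_mult (K := R_AbsRing) _ _ _ F1 H2)
                               (continuous_mult (K := R_AbsRing) _ _ _ F2 H1)).
Qed.

Lemma Ccontinuous_exp (F : C -> C) :
  Ccontinuous F -> Ccontinuous (fun z => Cexp (F z)).
Proof.
intros CF z; destruct (CF z) as [F1 F2].
assert (E := continuous_comp _ exp z F1 (continuous_exp (Re (F z)))).
split.
- exact (continuous_mult (K := R_AbsRing) _ _ _ E
           (continuous_comp _ cos z F2 (continuous_cos (Im (F z))))).
- exact (continuous_mult (K := R_AbsRing) _ _ _ E
           (continuous_comp _ sin z F2 (continuous_sin (Im (F z))))).
Qed.

(** * Primitives of holomorphic functions *)

(** The integral of the form [p du + r dv] along a path with one corner. *)
Definition potential (p r : R -> R -> R) (u v : R) : R :=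
  RInt (fun s => p s 0) 0 u + RInt (fun s => r u s) 0 v.

Lemma continuous_curry_l (f : R -> R -> R) (v u : R) :
  continuous (fun z : R * R => f (fst z) (snd z)) (u, v) ->
  continuous (fun s => f s v) u.
Proof.
intros H.
apply (continuous_comp_2 (fun s : R => s) (fun _ : R => v) f);
  [apply continuous_id|apply continuous_const|exact H].
Qed.

Lemma continuous_curry_r (f : R -> R -> R) (u v : R) :
  continuous (fun z : R * R => f (fst z) (snd z)) (u, v) ->
  continuous (f u) v.
Proof.
intros H.
apply (continuous_comp_2 (fun _ : R => u) (fun s : R => s) f);
  [apply continuous_const|apply continuous_id|exact H].
Qed.

Lemma is_derive_RInt_upper (f : R -> R) (a x : R) :
  (forall s, continuous f s) -> is_derive (fun y => RInt f a y) x (f x).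
Proof.
intros H; apply (is_derive_RInt f (fun y => RInt f a y) a x); [|apply H].
apply filter_forall; intros y; apply (RInt_correct f).
apply (ex_RInt_continuous (V := R_CompleteNormedModule)); intros; apply H.
Qed.

(** The form is closed, [d] being the common value of the two cross derivatives.
    The derivative in [v] is [r] by construction; for the derivative in [u] one
    differentiates under the integral sign and integrates [d] back to [p]. *)
Lemma potential_spec (p r d : R -> R -> R)
  (Hp : forall z : R * R, continuous (fun z : R * R => p (fst z) (snd z)) z)
  (Hr : forall z : R * R, continuous (fun z : R * R => r (fst z) (snd z)) z)
  (Hd : forall z : R * R, continuous (fun z : R * R => d (fst z) (snd z)) z)
  (Dp : forall u v, is_derive (fun s => p u s) v (d u v))
  (Dr : forall u v, is_derive (fun s => r s v) u (d u v))
  (x y : R -> R) (s x' y' : R) :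
  is_derive x s x' -> is_derive y s y' ->
  is_derive (fun t => potential p r (x t) (y t)) s
    (p (x s) (y s) * x' + r (x s) (y s) * y').
Proof.
intros Hx Hy.
assert (Du : forall u v, is_derive (fun z => potential p r z v) u (p u v)).
{ intros u v; unfold potential.
  apply is_derive_eq with
    (p u 0 + RInt (fun t => Derive (fun z => r z t) u) 0 v).
  - apply (is_derive_plus (V := R_NormedModule)).
    + apply (is_derive_RInt_upper (fun t => p t 0)); intros t.
      apply continuous_curry_l, Hp.
    + apply (is_derive_RInt_param (fun z t => r z t)).
      * apply filter_forall; intros z t _; now exists (d z t).
      * intros t _; apply continuity_2d_pt_ext with d.
        -- intros a b; symmetry; apply is_derive_unique, Dr.
        -- apply continuity_2d_pt_filterlim, (Hd (u, t)).
      * apply filter_forall; intros z.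
        apply (ex_RInt_continuous (V := R_CompleteNormedModule)); intros t _.
        apply continuous_curry_r, Hr.
  - rewrite (RInt_ext _ (fun t => d u t)).
    2: intros t _; apply is_derive_unique, Dr.
    rewrite (is_RInt_unique _ _ _ (minus (p u v) (p u 0))).
    + unfold minus, plus, opp; simpl; ring.
    + apply (is_RInt_derive (V := R_CompleteNormedModule)); intros t _; [apply Dp|].
      apply continuous_curry_r, Hd. }
apply is_derive_Reals, derivable_pt_lim_comp_2d.
2, 3: now apply is_derive_Reals.
apply filterdiff_differentiable_pt_lim.
apply (is_derive_filterdiff (potential p r) (x s) (y s) p (r (x s) (y s))).
- apply filter_forall; intros z; apply Du.
- apply is_derive_eq with (0 + r (x s) (y s)); [|ring].
  unfold potential; apply (is_derive_plus (V := R_NormedModule)).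
  + apply (is_derive_const (V := R_NormedModule)).
  + apply (is_derive_RInt_upper (fun t => r (x s) t)); intros t.
    apply continuous_curry_r, Hr.
- apply Hp.
Qed.

(** [F dz = (Re F du - Im F dv) + i (Im F du + Re F dv)]: a primitive of [F] is a
    pair of potentials. *)
Definition primitive (F : C -> C) (z : C) : C :=
  (potential (fun u v => Re (F (u, v))) (fun u v => - Im (F (u, v))) (Re z) (Im z),
   potential (fun u v => Im (F (u, v))) (fun u v => Re (F (u, v))) (Re z) (Im z)).

Lemma is_Cderive_horizontal (u v : R) : is_Cderive (fun s => (s, v)) u (RtoC 1).
Proof. split; [apply (is_derive_id u)|apply (is_derive_const v u)]. Qed.

Lemma is_Cderive_vertical (u v : R) : is_Cderive (fun s => (u, s)) v Ci.
Proof. split; [apply (is_derive_const u v)|apply (is_derive_id v)]. Qed.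

(** The Cauchy-Riemann equations say that the two real forms in [F dz] are
    closed. *)
Lemma primitive_spec (F F' : C -> C) :
  has_Cderivative F F' -> Ccontinuous F -> Ccontinuous F' ->
  has_Cderivative (primitive F) F.
Proof.
intros DF CF CF'.
assert (CFr : forall z : R * R, continuous (fun z : R * R => Re (F (fst z, snd z))) z).
{ intros [u v]; apply (continuous_ext (fun z : R * R => Re (F z)));
    [now intros []|apply CF]. }
assert (CFi : forall z : R * R, continuous (fun z : R * R => Im (F (fst z, snd z))) z).
{ intros [u v]; apply (continuous_ext (fun z : R * R => Im (F z)));
    [now intros []|apply CF]. }
assert (CFr' : forall z : R * R, continuous (fun z : R * R => Re (F' (fst z, snd z))) z).
{ intros [u v]; apply (continuous_ext (fun z : R * R => Re (F' z)));
    [now intros []|apply CF']. }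
assert (CFi' : forall z : R * R, continuous (fun z : R * R => Im (F' (fst z, snd z))) z).
{ intros [u v]; apply (continuous_ext (fun z : R * R => Im (F' z)));
    [now intros []|apply CF']. }
assert (Dh := fun u v => DF _ u _ (is_Cderive_horizontal u v)).
assert (Dv := fun u v => DF _ v _ (is_Cderive_vertical u v)).
intros c s l [H1 H2]; split.
- eapply is_derive_eq.
  + refine (potential_spec _ _ (fun u v => - Im (F' (u, v))) CFr _ _ _ _ _ _ s _ _ H1 H2).
    * intros z; exact (continuous_opp _ _ (CFi z)).
    * intros z; exact (continuous_opp _ _ (CFi' z)).
    * intros u v; eapply is_derive_eq; [exact (proj1 (Dv u v))|].
      unfold Re, Im; simpl; ring.
    * intros u v; eapply is_derive_eq;
        [exact (is_derive_opp _ _ _ (proj2 (Dh u v)))|].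
      unfold Re, Im; simpl; unfold opp; simpl; ring.
  + unfold Re, Im; simpl; rewrite <- surjective_pairing; ring.
- eapply is_derive_eq.
  + refine (potential_spec _ _ (fun u v => Re (F' (u, v))) CFi CFr CFr' _ _ _ _ s _ _ H1 H2).
    * intros u v; eapply is_derive_eq; [exact (proj2 (Dv u v))|].
      unfold Re, Im; simpl; ring.
    * intros u v; eapply is_derive_eq; [exact (proj1 (Dh u v))|].
      unfold Re, Im; simpl; ring.
  + unfold Re, Im; simpl; rewrite <- surjective_pairing; ring.
Qed.

(** * The mean value inequality *)

Lemma nondecreasing_of_derivative (f f' : R -> R) (a b : R) :
  a <= b -> (forall s, a <= s <= b -> is_derive f s (f' s)) ->
  (forall s, a <= s <= b -> 0 <= f' s) -> f a <= f b.
Proof.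
intros Hab Df Hf.
destruct (MVT_gen f a b f') as [c [Hc E]].
- intros x Hx; rewrite Rmin_left, Rmax_right in Hx by lra; apply Df; lra.
- intros x Hx; rewrite Rmin_left, Rmax_right in Hx by lra.
  apply continuity_pt_filterlim, (ex_derive_continuous f); exists (f' x); now apply Df.
- rewrite Rmin_left, Rmax_right in Hc by lra.
  assert (0 <= f' c * (b - a)) by (apply Rmult_le_pos; [now apply Hf|lra]); lra.
Qed.

Lemma Cmod_sqr (z : C) : Cmod z * Cmod z = Re z * Re z + Im z * Im z.
Proof. assert (H := Cmod2_alt z); simpl in H; lra. Qed.

Lemma inner_le_Cmod (z w : C) : Re z * Re w + Im z * Im w <= Cmod z * Cmod w.
Proof.
apply Rle_trans with (Rabs (Re (Cconj z * w))).
- apply Rle_trans with (Re (Cconj z * w)); [|apply Rle_abs].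
  unfold Re, Im; simpl; lra.
- rewrite <- (Cmod_conj z), <- Cmod_mult; apply re_le_Cmod.
Qed.

(** Project the increment [c b - c a] on its own direction and compare real
    derivatives.  All the bounds on integrals below are obtained in this way, [k]
    being an explicit antiderivative of a bound for the integrand. *)
Lemma mean_value_inequality (c c' : R -> C) (k k' : R -> R) (a b : R) :
  a <= b ->
  (forall s, a <= s <= b -> is_Cderive c s (c' s)) ->
  (forall s, a <= s <= b -> is_derive k s (k' s)) ->
  (forall s, a <= s <= b -> Cmod (c' s) <= k' s) ->
  Cmod (c b - c a) <= k b - k a.
Proof.
intros Hab Dc Dk Hle; set (d := (c b - c a)%C).
assert (Hd : Re d = Re (c b) - Re (c a) /\ Im d = Im (c b) - Im (c a)) by (split; reflexivity).
assert (M : Cmod d * k a - (Re d * Re (c a) + Im d * Im (c a)) <=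
            Cmod d * k b - (Re d * Re (c b) + Im d * Im (c b))).
{ apply (nondecreasing_of_derivative
    (fun s => Cmod d * k s - (Re d * Re (c s) + Im d * Im (c s)))
    (fun s => Cmod d * k' s - (Re d * Re (c' s) + Im d * Im (c' s)))); trivial.
  - intros s Hs; destruct (Dc s Hs) as [D1 D2].
    apply (is_derive_minus (V := R_NormedModule)).
    + apply (is_derive_scal (fun s => k s)); now apply Dk.
    + apply (is_derive_plus (V := R_NormedModule)).
      * now apply (is_derive_scal (fun s => Re (c s))).
      * now apply (is_derive_scal (fun s => Im (c s))).
  - intros s Hs; assert (I := inner_le_Cmod d (c' s)).
    assert (J := Rmult_le_compat_l _ _ _ (Cmod_ge_0 d) (Hle s Hs)); lra. }
assert (S := Cmod_sqr d).
assert (Q : Cmod d * Cmod d <= Cmod d * (k b - k a)).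
{ rewrite S; destruct Hd as [E1 E2].
  replace (Re d * Re d + Im d * Im d) with
    (Re d * Re (c b) + Im d * Im (c b) - (Re d * Re (c a) + Im d * Im (c a)))
    by (rewrite E1, E2; ring).
  lra. }
destruct (Rle_lt_or_eq_dec _ _ (Cmod_ge_0 d)) as [P|P].
- apply Rmult_le_reg_l with (Cmod d); lra.
- rewrite <- P.
  enough (k a <= k b) by lra.
  apply (nondecreasing_of_derivative k k'); trivial.
  intros s Hs; apply Rle_trans with (Cmod (c' s)); [apply Cmod_ge_0|now apply Hle].
Qed.

Lemma mean_value_inequality_abs (c c' : R -> C) (M x y : R) :
  0 <= M -> (forall s, is_Cderive c s (c' s)) ->
  (forall s, Rabs s <= Rmax (Rabs x) (Rabs y) -> Cmod (c' s) <= M) ->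
  Cmod (c y - c x) <= M * Rabs (y - x).
Proof.
intros HM Dc Hc.
assert (Main : forall x y, x <= y ->
  (forall s, Rabs s <= Rmax (Rabs x) (Rabs y) -> Cmod (c' s) <= M) ->
  Cmod (c y - c x) <= M * (y - x)).
{ intros u v Huv H; rewrite Rmult_minus_distr_l.
  apply (mean_value_inequality c c' (fun s => M * s) (fun _ => M)); trivial.
  - intros s _; auto_derive; [trivial|ring].
  - intros s Hs; apply H; unfold Rmax, Rabs; repeat destruct Rcase_abs; destruct Rle_dec; lra. }
destruct (Rle_dec x y) as [L|L].
- rewrite (Rabs_pos_eq (y - x)) by lra; now apply Main.
- rewrite (Rabs_left1 (y - x)) by lra.
  replace (c y - c x)%C with (- (c x - c y))%C by ring.
  rewrite Cmod_opp; replace (- (y - x)) with (x - y) by ring.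
  apply Main; [lra|]; now rewrite Rmax_comm.
Qed.

(** * Limits at infinity of complex-valued functions *)

Definition is_Clim (F : R -> C) (l : C) : Prop :=
  is_lim (fun s => Re (F s)) p_infty (Re l) /\
  is_lim (fun s => Im (F s)) p_infty (Im l).

Definition Clim (F : R -> C) : C :=
  (real (Lim (fun s => Re (F s)) p_infty), real (Lim (fun s => Im (F s)) p_infty)).

Lemma Im_le_Cmod (z : C) : Rabs (Im z) <= Cmod z.
Proof. exact (Rle_trans _ _ _ (Rmax_r _ _) (Rmax_Cmod z)). Qed.

Lemma is_Clim_le (F : R -> C) (l : C) (s0 M : R) :
  is_Clim F l -> (forall s, s0 <= s -> Cmod (F s) <= M) -> Cmod l <= M.
Proof.
intros [H1 H2] HM.
assert (PM : 0 <= M) by (apply Rle_trans with (Cmod (F s0)); [apply Cmod_ge_0|apply HM; lra]).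
apply Rsqr_incr_0_var; [|exact PM].
unfold Rsqr; rewrite Cmod_sqr.
assert (L : is_lim (fun s => Re (F s) * Re (F s) + Im (F s) * Im (F s)) p_infty
              (Re l * Re l + Im l * Im l)).
{ exact (is_lim_plus' _ _ _ _ _ (is_lim_mult _ _ _ _ _ H1 H1 I)
                              (is_lim_mult _ _ _ _ _ H2 H2 I)). }
refine (is_lim_le_loc _ (fun _ => M * M) p_infty _ (M * M) _ L (is_lim_const _ _)).
exists s0; intros s Hs; rewrite <- Cmod_sqr.
assert (Q := HM s (Rlt_le _ _ Hs)); assert (Q' := Cmod_ge_0 (F s)).
now apply Rmult_le_compat.
Qed.

Lemma is_Clim_of_rate (F : R -> C) (l : C) (e : R -> R) (s0 : R) :
  (forall s, s0 <= s -> Cmod (F s - l) <= e s) -> is_lim e p_infty 0 -> is_Clim F l.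
Proof.
intros H He.
assert (Hm : is_lim (fun s => - e s) p_infty 0).
{ replace (Finite 0) with (Rbar_opp 0) by (simpl; now rewrite Ropp_0).
  now apply is_lim_opp. }
split.
- apply (is_lim_le_le_loc (fun s => Re l + - e s) (fun s => Re l + e s)).
  + exists s0; intros s Hs; assert (Q := H s (Rlt_le _ _ Hs)).
    assert (Q' := Rle_trans _ _ _ (re_le_Cmod _) Q).
    apply Rabs_le_between in Q'; simpl in Q'; unfold Re in *; simpl in *; lra.
  + replace (Finite (Re l)) with (Finite (Re l + 0)) by (now rewrite Rplus_0_r).
    apply is_lim_plus'; [apply is_lim_const|exact Hm].
  + replace (Finite (Re l)) with (Finite (Re l + 0)) by (now rewrite Rplus_0_r).
    apply is_lim_plus'; [apply is_lim_const|exact He].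
- apply (is_lim_le_le_loc (fun s => Im l + - e s) (fun s => Im l + e s)).
  + exists s0; intros s Hs; assert (Q := H s (Rlt_le _ _ Hs)).
    assert (Q' := Rle_trans _ _ _ (Im_le_Cmod _) Q).
    apply Rabs_le_between in Q'; unfold Im in *; simpl in *; lra.
  + replace (Finite (Im l)) with (Finite (Im l + 0)) by (now rewrite Rplus_0_r).
    apply is_lim_plus'; [apply is_lim_const|exact Hm].
  + replace (Finite (Im l)) with (Finite (Im l + 0)) by (now rewrite Rplus_0_r).
    apply is_lim_plus'; [apply is_lim_const|exact He].
Qed.

Lemma ex_lim_of_Cauchy_rate (f e : R -> R) (s0 : R) :
  (forall s t, s0 <= s <= t -> Rabs (f t - f s) <= e s) -> is_lim e p_infty 0 ->
  is_lim f p_infty (real (Lim f p_infty)).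
Proof.
intros H He.
assert (C : exists y : R, filterlim f (Rbar_locally p_infty) (locally y)).
{ apply (filterlim_locally_cauchy (U := R_CompleteSpace) f); intros eps.
  assert (He2 := proj2 (is_lim_spec e p_infty (Finite 0)) He (pos_div_2 eps)).
  destruct He2 as [S HS].
  set (S' := Rmax s0 S + 1).
  exists (fun s => S' < s); split; [now exists S'|].
  intros u v Hu Hv.
  assert (B0 := Rmax_l s0 S); assert (B1 := Rmax_r s0 S).
  assert (E := HS S' ltac:(unfold S'; lra)); simpl in E.
  rewrite Rminus_0_r in E; apply Rabs_lt_between in E.
  assert (Qu := H S' u ltac:(unfold S' in *; lra)).
  assert (Qv := H S' v ltac:(unfold S' in *; lra)).
  apply Rabs_le_between in Qu, Qv.
  change (Rabs (f v - f u) < eps); apply Rabs_lt_between; lra. }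
destruct C as [y Hy].
assert (Hy' : is_lim f p_infty y) by exact Hy.
now rewrite (is_lim_unique _ _ _ Hy').
Qed.

(** A Cauchy condition with an explicit rate passes to the limit, so convergence
    comes together with its speed; the uniform estimates rest on this. *)
Lemma Clim_of_Cauchy_rate (F : R -> C) (e : R -> R) (s0 : R) :
  (forall s t, s0 <= s <= t -> Cmod (F t - F s) <= e s) -> is_lim e p_infty 0 ->
  is_Clim F (Clim F) /\ (forall s, s0 <= s -> Cmod (Clim F - F s) <= e s).
Proof.
intros H He.
assert (L : is_Clim F (Clim F)).
{ split.
  - apply (ex_lim_of_Cauchy_rate _ e s0); trivial; intros s t Hst.
    refine (Rle_trans _ _ _ _ (H s t Hst)); exact (re_le_Cmod (F t - F s)).
  - apply (ex_lim_of_Cauchy_rate _ e s0); trivial; intros s t Hst.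
    refine (Rle_trans _ _ _ _ (H s t Hst)); exact (Im_le_Cmod (F t - F s)). }
split; [exact L|]; intros s Hs.
apply is_Clim_le with (fun t => F t - F s)%C s.
- destruct L as [L1 L2]; split.
  + exact (is_lim_plus' _ _ _ _ _ L1 (is_lim_const _ _)).
  + exact (is_lim_plus' _ _ _ _ _ L2 (is_lim_const _ _)).
- intros t Ht; apply H; lra.
Qed.

Lemma is_Clim_plus (F H : R -> C) (l m : C) :
  is_Clim F l -> is_Clim H m -> is_Clim (fun s => F s + H s)%C (l + m)%C.
Proof.
intros [F1 F2] [H1 H2]; split.
- exact (is_lim_plus' _ _ _ _ _ F1 H1).
- exact (is_lim_plus' _ _ _ _ _ F2 H2).
Qed.

Lemma is_Clim_minus (F H : R -> C) (l m : C) :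
  is_Clim F l -> is_Clim H m -> is_Clim (fun s => F s - H s)%C (l - m)%C.
Proof.
intros [F1 F2] [H1 H2]; split.
- exact (is_lim_minus' _ _ _ _ _ F1 H1).
- exact (is_lim_minus' _ _ _ _ _ F2 H2).
Qed.

Lemma is_Clim_scal (z : C) (F : R -> C) (l : C) :
  is_Clim F l -> is_Clim (fun s => z * F s)%C (z * l)%C.
Proof.
intros [F1 F2]; split.
- exact (is_lim_minus' _ _ _ _ _ (is_lim_scal_l _ (Re z) _ _ F1)
                                  (is_lim_scal_l _ (Im z) _ _ F2)).
- exact (is_lim_plus' _ _ _ _ _ (is_lim_scal_l _ (Re z) _ _ F2)
                                 (is_lim_scal_l _ (Im z) _ _ F1)).
Qed.

Lemma is_Clim_sum_n (F : nat -> R -> C) (l : nat -> C) (n : nat) :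
  (forall k, is_Clim (F k) (l k)) ->
  is_Clim (fun s => sum_n (fun k => F k s) n) (sum_n l n).
Proof.
intros H; induction n as [|n IH].
- rewrite sum_O; destruct (H 0%nat) as [H1 H2]; split.
  + refine (is_lim_ext _ _ _ _ _ H1); intros; now rewrite sum_O.
  + refine (is_lim_ext _ _ _ _ _ H2); intros; now rewrite sum_O.
- rewrite sum_Sn; destruct (is_Clim_plus _ _ _ _ IH (H (S n))) as [H1 H2]; split.
  + refine (is_lim_ext _ _ _ _ _ H1); intros; now rewrite sum_Sn.
  + refine (is_lim_ext _ _ _ _ _ H2); intros; now rewrite sum_Sn.
Qed.

Lemma is_Clim_ext (F H : R -> C) (l : C) :
  (forall s, F s = H s) -> is_Clim F l -> is_Clim H l.
Proof.
intros E [H1 H2]; split.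
- refine (is_lim_ext _ _ _ _ _ H1); intros; now rewrite E.
- refine (is_lim_ext _ _ _ _ _ H2); intros; now rewrite E.
Qed.

Lemma is_lim_affine (k d : R) : 0 < k -> is_lim (fun s => k * s - d) p_infty p_infty.
Proof.
intros Hk; apply is_lim_spec; intros M; exists ((M + d) / k); intros s Hs.
assert (H := Rmult_lt_compat_l k _ _ Hk Hs).
replace (k * ((M + d) / k)) with (M + d) in H by (field; lra); lra.
Qed.

Lemma is_lim_comp_affine (f : R -> R) (l : Rbar) (k d : R) :
  0 < k -> is_lim f p_infty l -> is_lim (fun s => f (k * s - d)) p_infty l.
Proof.
intros Hk H; apply (is_lim_comp f (fun s => k * s - d) p_infty l p_infty H).
- now apply is_lim_affine.
- now exists 0.
Qed.

Lemma is_Clim_shift (F : R -> C) (l : C) (d : R) :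
  is_Clim F l -> is_Clim (fun s => F (s - d)) l.
Proof.
intros [H1 H2]; split.
- apply (is_lim_ext (fun s => Re (F (1 * s - d)))); [intros; now rewrite Rmult_1_l|].
  apply (is_lim_comp_affine (fun s => Re (F s))); [lra|exact H1].
- apply (is_lim_ext (fun s => Im (F (1 * s - d)))); [intros; now rewrite Rmult_1_l|].
  apply (is_lim_comp_affine (fun s => Im (F s))); [lra|exact H2].
Qed.

(** * The integrand in the logarithmic variable *)

Lemma inv_ln_pos (q : R) : 0 < q < 1 -> 0 < - (1 / (2 * ln q)).
Proof.
intros Hq; assert (Hl : ln q < 0) by (rewrite <- ln_1; apply ln_increasing; lra).
replace (- (1 / (2 * ln q))) with (1 / (2 * - ln q)) by (field; lra).
apply Rdiv_lt_0_compat; lra.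
Qed.

Lemma Cmod_Cexp (z : C) : Cmod (Cexp z) = exp (Re z).
Proof.
unfold Cmod, Cexp; simpl.
replace (_ + _) with (Rsqr (exp (Re z))).
- apply sqrt_Rsqr, Rlt_le, exp_pos.
- assert (H := sin2_cos2 (Im z)); unfold Rsqr in *.
  transitivity (exp (Re z) * exp (Re z) *
    (sin (Im z) * sin (Im z) + cos (Im z) * cos (Im z))); [rewrite H|]; ring.
Qed.

Lemma Cexp_plus (z w : C) : Cexp (z + w)%C = (Cexp z * Cexp w)%C.
Proof.
unfold Cexp; apply Ceq; rewrite !re_plus, !im_plus, exp_plus, ?cos_plus, ?sin_plus;
  unfold Re, Im; simpl; ring.
Qed.

Definition gauss (a : R) (b w : C) : C := Cexp (RtoC a * ((w - b) * (w - b)))%C.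

(** The integrand of [h] for the measure [dt / t], after the substitution
    [t = e^w]; [b] stands for [log x - (ln q) / 2] and [a] for [- 1 / (2 ln q)]. *)
Definition Phi (a : R) (b w : C) : C :=
  Cexp (Cexp w + RtoC a * ((w - b) * (w - b)))%C.

Lemma gauss_arg_Cderivative (a : R) (b : C) :
  has_Cderivative (fun w => RtoC a * ((w - b) * (w - b)))%C
                  (fun w => RtoC (2 * a) * (w - b))%C.
Proof.
assert (D := has_Cderivative_minus _ _ _ _ has_Cderivative_id (has_Cderivative_const b)).
refine (has_Cderivative_ext _ _ _ _
  (has_Cderivative_mult _ _ _ _ (has_Cderivative_const (RtoC a))
     (has_Cderivative_mult _ _ _ _ D D))).
intros z; cbv beta; rewrite RtoC_mult; ring.
Qed.

Lemma Ccontinuous_affine (k b : C) : Ccontinuous (fun w => k * (w - b))%C.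
Proof.
exact (Ccontinuous_mult _ _ (Ccontinuous_const k)
         (Ccontinuous_minus _ _ Ccontinuous_id (Ccontinuous_const b))).
Qed.

Lemma Ccontinuous_gauss_arg (a : R) (b : C) :
  Ccontinuous (fun w => RtoC a * ((w - b) * (w - b)))%C.
Proof.
assert (D := Ccontinuous_minus _ _ Ccontinuous_id (Ccontinuous_const b)).
exact (Ccontinuous_mult _ _ (Ccontinuous_const (RtoC a)) (Ccontinuous_mult _ _ D D)).
Qed.

Lemma gauss_Cderivative (a : R) (b : C) :
  has_Cderivative (gauss a b) (fun w => gauss a b w * (RtoC (2 * a) * (w - b)))%C.
Proof.
exact (has_Cderivative_comp _ _ _ _ has_Cderivative_exp (gauss_arg_Cderivative a b)).
Qed.

Lemma Ccontinuous_gauss (a : R) (b : C) : Ccontinuous (gauss a b).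
Proof. apply Ccontinuous_exp, Ccontinuous_gauss_arg. Qed.

Lemma gauss_primitive (a : R) (b : C) :
  has_Cderivative (primitive (gauss a b)) (gauss a b).
Proof.
apply primitive_spec with (1 := gauss_Cderivative a b); [apply Ccontinuous_gauss|].
exact (Ccontinuous_mult _ _ (Ccontinuous_gauss a b) (Ccontinuous_affine _ b)).
Qed.

Lemma Ccontinuous_Phi (a : R) (b : C) : Ccontinuous (Phi a b).
Proof.
exact (Ccontinuous_exp _ (Ccontinuous_plus _ _ (Ccontinuous_exp _ Ccontinuous_id)
         (Ccontinuous_gauss_arg a b))).
Qed.

Lemma Phi_Cderivative (a : R) (b : C) :
  has_Cderivative (Phi a b) (fun w => Phi a b w * (Cexp w + RtoC (2 * a) * (w - b)))%C.
Proof.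
exact (has_Cderivative_comp _ _ _ _ has_Cderivative_exp
  (has_Cderivative_plus _ _ _ _ has_Cderivative_exp (gauss_arg_Cderivative a b))).
Qed.

Lemma Phi_primitive (a : R) (b : C) :
  has_Cderivative (primitive (Phi a b)) (Phi a b).
Proof.
apply primitive_spec with (1 := Phi_Cderivative a b); [apply Ccontinuous_Phi|].
exact (Ccontinuous_mult _ _ (Ccontinuous_Phi a b)
         (Ccontinuous_plus _ _ (Ccontinuous_exp _ Ccontinuous_id)
            (Ccontinuous_affine _ b))).
Qed.

Lemma Cmod_gauss (a : R) (b : C) (u v : R) :
  Cmod (gauss a b (u, v)) =
  exp (a * ((u - Re b) * (u - Re b)) - a * ((v - Im b) * (v - Im b))).
Proof.
unfold gauss; rewrite Cmod_Cexp; f_equal; unfold Re, Im; simpl; ring.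
Qed.

Lemma Cmod_Phi (a : R) (b : C) (u v : R) :
  Cmod (Phi a b (u, v)) =
  exp (exp u * cos v + (a * ((u - Re b) * (u - Re b)) - a * ((v - Im b) * (v - Im b)))).
Proof.
unfold Phi; rewrite Cmod_Cexp; f_equal; unfold Re, Im; simpl; ring.
Qed.

(** * Values of a primitive at the ends of the contour *)

Lemma exp_le (x y : R) : x <= y -> exp x <= exp y.
Proof. intros [H|H]; [left; now apply exp_increasing|right; now rewrite H]. Qed.

Lemma exp_ge_cubic (s : R) : 0 <= s -> 1 + s + s * s / 2 + s * s * s / 6 <= exp s.
Proof.
intros Hs.
assert (H1 : forall t, 0 <= t -> 0 <= exp t - (1 + t + t * t / 2)).
{ intros t Ht.
  apply Rle_trans with (exp 0 - (1 + 0 + 0 * 0 / 2)); [rewrite exp_0; lra|].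
  apply (nondecreasing_of_derivative (fun t => exp t - (1 + t + t * t / 2))
           (fun t => exp t - (1 + t))); trivial.
  - intros u _; auto_derive; [trivial|field].
  - intros u _; assert (H := exp_ineq1_le u); lra. }
enough (0 <= exp s - (1 + s + s * s / 2 + s * s * s / 6)) by lra.
apply Rle_trans with (exp 0 - (1 + 0 + 0 * 0 / 2 + 0 * 0 * 0 / 6)); [rewrite exp_0; lra|].
apply (nondecreasing_of_derivative (fun t => exp t - (1 + t + t * t / 2 + t * t * t / 6))
         (fun t => exp t - (1 + t + t * t / 2))); trivial.
- intros u _; auto_derive; [trivial|field].
- intros u [Hu _]; now apply H1.
Qed.

(** At the ends of the contour [e^w] contributes [- e^s] to the exponent of the
    integrand, and the quadratic term at most [2 c s^2] up to a constant.  Keeping a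
    margin [s] leaves an integrable [e^(- s)]. *)
Lemma exp_dominates_quadratic (c s : R) :
  0 <= c -> 0 <= s -> 2 * c * (s * s) + s <= exp s + 288 * (c * c * c).
Proof.
intros Hc Hs; assert (H := exp_ge_cubic s Hs).
assert (Hss := Rmult_le_pos _ _ Hs Hs).
enough (2 * c * (s * s) <= s * s * s / 6 + 288 * (c * c * c)) by lra.
assert (C3 : 0 <= c * c * c) by (repeat apply Rmult_le_pos; lra).
(* The cubic term of the exponential series beats [2 c s^2] beyond [s = 12 c]. *)
destruct (Rle_dec s (12 * c)) as [L|L].
- assert (E : s * s <= 12 * c * (12 * c)) by (apply Rmult_le_compat; lra).
  assert (2 * c * (s * s) <= 2 * c * (12 * c * (12 * c))) by (apply Rmult_le_compat_l; lra).
  assert (0 <= s * s * s) by (apply Rmult_le_pos; lra). lra.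
- assert (12 * c * (s * s) <= s * (s * s)) by (apply Rmult_le_compat_r; lra). lra.
Qed.

Lemma sqr_diff_le (u b B : R) :
  Rabs b <= B -> (u - b) * (u - b) <= 2 * (u * u) + 2 * (B * B).
Proof.
intros H; assert (Hb : b * b <= B * B).
{ apply Rsqr_le_abs_1; rewrite (Rabs_pos_eq B); trivial.
  now apply Rle_trans with (1 := Rabs_pos b). }
assert (Q := Rle_0_sqr (u + b)); unfold Rsqr in Q; lra.
Qed.

Definition ray_const (a B : R) : R := exp (288 * (a * a * a) + 2 * a * (B * B)).
(** Only half of [e^u] is available in the strip of [Cmod_Phi_strip], so the
    quadratic bound is used with [2 a] and halved: [1152 = 288 * 8 / 2]. *)
Definition strip_const (a B : R) : R := exp (1152 * (a * a * a) + 2 * a * (B * B)).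

(** The bound separates the height [v] of the ray from the position [u] on it.
    The Gaussian factor in [v] makes far rays negligible. *)
Lemma Cmod_Phi_ray (a B u v : R) (b : C) :
  0 < a -> Rabs (Re b) <= B -> 0 <= u -> cos v = -1 ->
  Cmod (Phi a b (u, v)) <=
  ray_const a B * exp (- (a * ((v - Im b) * (v - Im b)))) * exp (- u).
Proof.
intros Ha Hb Hu Hv; rewrite Cmod_Phi, Hv; unfold ray_const.
rewrite <- !exp_plus; apply exp_le.
assert (H1 := exp_dominates_quadratic a u ltac:(lra) Hu).
assert (H2 := Rmult_le_compat_l a _ _ ltac:(lra) (sqr_diff_le u _ _ Hb)); lra.
Qed.

(** Within [PI / 3] of an odd multiple of [PI] the cosine is at most [- 1 / 2], so
    the double exponential decay persists off the ray. *)
Lemma Cmod_Phi_strip (a B u v v0 : R) (b : C) :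
  0 < a -> Rabs (Re b) <= B -> 0 <= u -> cos v0 = -1 -> Rabs (v - v0) <= PI / 3 ->
  Cmod (Phi a b (u, v)) <= strip_const a B.
Proof.
intros Ha Hb Hu Hv0 Hv; rewrite Cmod_Phi; unfold strip_const; apply exp_le.
assert (Cv : cos v <= - (1 / 2)).
{ assert (S0 : sin v0 = 0).
  { assert (Q := sin2_cos2 v0); rewrite Hv0 in Q; unfold Rsqr in Q.
    apply Rsqr_0_uniq; unfold Rsqr; lra. }
  replace v with (v0 + (v - v0)) by ring.
  rewrite cos_plus, Hv0, S0.
  assert (P := PI_RGT_0).
  enough (1 / 2 <= cos (v - v0)) by lra.
  rewrite <- cos_PI3.
  assert (E : cos (v - v0) = cos (Rabs (v - v0))).
  { unfold Rabs; destruct (Rcase_abs (v - v0)); [now rewrite cos_neg|reflexivity]. }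
  rewrite E; assert (Q := Rabs_pos (v - v0)).
  apply cos_decr_1; lra. }
assert (H1 := exp_dominates_quadratic (2 * a) u ltac:(lra) Hu).
assert (H2 := Rmult_le_compat_l a _ _ ltac:(lra) (sqr_diff_le u _ _ Hb)).
assert (H3 := exp_pos u).
assert (H4 : exp u * cos v <= exp u * - (1 / 2)) by (apply Rmult_le_compat_l; lra).
assert (H5 := Rmult_le_pos a _ ltac:(lra) (Rle_0_sqr (v - Im b))); unfold Rsqr in H5.
lra.
Qed.

Lemma is_lim_scal_exp_neg (K : R) : is_lim (fun s => K * exp (- s)) p_infty 0.
Proof.
replace (Finite 0) with (Rbar_mult K 0) by (simpl; now rewrite Rmult_0_r).
apply is_lim_scal_l.
apply (is_lim_comp exp Ropp p_infty 0 m_infty).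
- apply is_lim_exp_m.
- apply (is_lim_opp (fun s => s) p_infty p_infty), is_lim_id.
- now exists 0.
Qed.

Definition end_value (G : C -> C) (v : R) : C := Clim (fun u => G (u, v)).

(** Integrate [Cmod_Phi_ray] along the ray from [u] to infinity. *)
Lemma end_value_rate (a B : R) (b : C) (G : C -> C) (v : R) :
  0 < a -> Rabs (Re b) <= B -> has_Cderivative G (Phi a b) -> cos v = -1 ->
  forall u, 0 <= u ->
  Cmod (end_value G v - G (u, v)) <=
  ray_const a B * exp (- (a * ((v - Im b) * (v - Im b)))) * exp (- u).
Proof.
intros Ha Hb DG Hv.
set (D := ray_const a B * exp (- (a * ((v - Im b) * (v - Im b))))).
apply (Clim_of_Cauchy_rate (fun u => G (u, v)) (fun u => D * exp (- u)) 0).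
2: apply is_lim_scal_exp_neg.
intros s t Hst.
apply Rle_trans with (- D * exp (- t) - - D * exp (- s)).
- apply (mean_value_inequality (fun u => G (u, v)) (fun u => Phi a b (u, v) * RtoC 1)%C
           (fun u => - D * exp (- u)) (fun u => D * exp (- u))); [lra| | |].
  + intros u _; exact (DG _ _ _ (is_Cderive_horizontal u v)).
  + intros u _; auto_derive; [trivial|ring].
  + intros u Hu; rewrite Cmult_1_r; apply Cmod_Phi_ray; trivial; lra.
- assert (0 < D) by (apply Rmult_lt_0_compat; apply exp_pos).
  assert (0 <= D * exp (- t)) by (apply Rmult_le_pos; [lra|apply Rlt_le, exp_pos]); lra.
Qed.

(** The integrand is bounded on the strip independently of [u]; hence [G] has the
    same limit along every curve that runs to infinity while approaching the ray. *)
Lemma strip_variation (a B : R) (b : C) (G : C -> C) (v0 : R) :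
  0 < a -> Rabs (Re b) <= B -> has_Cderivative G (Phi a b) -> cos v0 = -1 ->
  forall u v, 0 <= u -> Rabs (v - v0) <= PI / 3 ->
  Cmod (G (u, v) - G (u, v0)) <= strip_const a B * Rabs (v - v0).
Proof.
intros Ha Hb DG Hv0.
assert (Main : forall u s t, 0 <= u -> s <= t -> Rabs (s - v0) <= PI / 3 ->
  Rabs (t - v0) <= PI / 3 -> Cmod (G (u, t) - G (u, s)) <= strip_const a B * (t - s)).
{ intros u s t Hu Hst Hs Ht.
  rewrite Rmult_minus_distr_l.
  apply (mean_value_inequality (fun y => G (u, y)) (fun y => Phi a b (u, y) * Ci)%C
           (fun y => strip_const a B * y) (fun _ => strip_const a B)); trivial.
  - intros y _; exact (DG _ _ _ (is_Cderive_vertical u y)).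
  - intros y _; auto_derive; [trivial|ring].
  - intros y Hy; rewrite Cmod_mult, Cmod_Ci, Rmult_1_r.
    apply Cmod_Phi_strip with v0; trivial.
    apply Rabs_le_between in Hs, Ht; apply Rabs_le_between; lra. }
assert (P := PI_RGT_0).
assert (Z : Rabs (v0 - v0) <= PI / 3) by (rewrite Rminus_diag, Rabs_R0; lra).
intros u v Hu Hv; destruct (Rle_dec v0 v) as [L|L].
- rewrite (Rabs_pos_eq (v - v0)) by lra; now apply Main.
- rewrite (Rabs_left1 (v - v0)) by lra.
  replace (G (u, v) - G (u, v0))%C with (- (G (u, v0) - G (u, v)))%C by ring.
  rewrite Cmod_opp; replace (- (v - v0)) with (v0 - v) by ring.
  apply Main; trivial; lra.
Qed.

(** This covers an arbitrary contour: neither its speed nor its length is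
    controlled, only the limits of the real and imaginary parts of [w]. *)
Lemma end_value_limit (a B : R) (b : C) (G : C -> C) (v0 : R) (F : (R -> Prop) -> Prop)
    (FF : Filter F) (x y : R -> R) :
  0 < a -> Rabs (Re b) <= B -> has_Cderivative G (Phi a b) -> cos v0 = -1 ->
  filterlim x F (Rbar_locally p_infty) -> filterlim y F (locally v0) ->
  forall eps, 0 < eps -> F (fun s => Cmod (G (x s, y s) - end_value G v0) < eps).
Proof.
intros Ha Hb DG Hv0 Hx Hy eps Heps.
set (D := ray_const a B * exp (- (a * ((v0 - Im b) * (v0 - Im b))))).
assert (HS : 0 < strip_const a B) by apply exp_pos.
assert (Hl : Rbar_locally p_infty (fun u => 0 < u /\ D * exp (- u) < eps / 2)).
{ destruct (proj2 (is_lim_spec _ _ (Finite 0)) (is_lim_scal_exp_neg D)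
             (mkposreal (eps / 2) ltac:(lra))) as [M HM].
  exists (Rmax 0 M); intros u Hu.
  assert (Q := Rmax_l 0 M); assert (Q' := Rmax_r 0 M); split; [lra|].
  assert (E := HM u ltac:(lra)); simpl in E; apply Rabs_lt_between in E; lra. }
assert (P := PI_RGT_0).
(* First far enough on the ray, then close enough to it. *)
set (d := Rmin (PI / 3) (eps / 2 / strip_const a B)).
assert (Hd : 0 < d).
{ apply Rmin_glb_lt; [lra|]; apply Rdiv_lt_0_compat; lra. }
assert (Fx : F (fun s => 0 < x s /\ D * exp (- x s) < eps / 2)) by exact (Hx _ Hl).
assert (Fy : F (fun s => Rabs (y s - v0) < d))
  by exact (Hy _ (locally_ball v0 (mkposreal d Hd))).
generalize (filter_and _ _ Fx Fy); apply filter_imp; intros s [[H1 H2] H3].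
assert (V := strip_variation a B b G v0 Ha Hb DG Hv0 (x s) (y s) ltac:(lra)
  ltac:(apply Rle_trans with d; [lra|apply Rmin_l])).
assert (T := end_value_rate a B b G v0 Ha Hb DG Hv0 (x s) ltac:(lra)); fold D in T.
replace (G (x s, y s) - end_value G v0)%C with
  ((G (x s, y s) - G (x s, v0)) + - (end_value G v0 - G (x s, v0)))%C by ring.
eapply Rle_lt_trans; [apply Cmod_triangle|]; rewrite Cmod_opp.
assert (W : strip_const a B * Rabs (y s - v0) < eps / 2); [|lra].
apply Rlt_le_trans with (strip_const a B * d); [now apply Rmult_lt_compat_l|].
apply Rle_trans with (strip_const a B * (eps / 2 / strip_const a B)).
- apply Rmult_le_compat_l; [lra|apply Rmin_r].
- right; field; lra.
Qed.

(** * Values of a primitive at the ends of the imaginary axis *)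

Lemma is_lim_exp_affine (K a d : R) :
  0 < a -> is_lim (fun s => K * exp (- (a * (s - d)))) p_infty 0.
Proof.
intros Ha.
replace (Finite 0) with (Rbar_mult K 0) by (simpl; now rewrite Rmult_0_r).
apply is_lim_scal_l.
apply (is_lim_comp exp (fun s => - (a * (s - d))) p_infty 0 m_infty).
- apply is_lim_exp_m.
- apply is_lim_spec; intros M; exists (d - M / a); intros s Hs.
  assert (H := Rmult_lt_compat_l a _ _ Ha Hs).
  replace (a * (d - M / a)) with (a * d - M) in H by (field; lra); lra.
- now exists 0.
Qed.

(** The limit of [G] at the upper ([sigma = 1]) or lower ([sigma = -1]) end of the
    imaginary axis. *)
Definition vertical_value (G : C -> C) (sigma : R) : C := Clim (fun s => G (0, sigma * s)).
Definition tail_const (a B : R) : R := exp (1 + a * (B * B)).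

Lemma Cmod_Phi_imaginary (a B : R) (b : C) (v : R) :
  0 < a -> Rabs (Re b) <= B ->
  Cmod (Phi a b (0, v)) <= tail_const a B * exp (- (a * ((v - Im b) * (v - Im b)))).
Proof.
intros Ha Hb; rewrite Cmod_Phi; unfold tail_const; rewrite <- exp_plus; apply exp_le.
assert (H1 := COS_bound v); rewrite exp_0.
assert (H2 : (0 - Re b) * (0 - Re b) <= B * B).
{ replace ((0 - Re b) * (0 - Re b)) with (Rsqr (Re b)) by (unfold Rsqr; ring).
  apply Rsqr_le_abs_1; rewrite (Rabs_pos_eq B); trivial.
  now apply Rle_trans with (1 := Rabs_pos (Re b)). }
assert (H3 := Rmult_le_compat_l a _ _ ltac:(lra) H2); lra.
Qed.

Lemma sqr_sign (sigma s t : R) :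
  sigma * sigma = 1 -> (sigma * s - t) * (sigma * s - t) = (s - sigma * t) * (s - sigma * t).
Proof.
intros H.
transitivity (sigma * sigma * (s * s) - 2 * (sigma * s * t) + t * t); [ring|].
transitivity (s * s - 2 * (sigma * s * t) + sigma * sigma * (t * t)); [|ring].
rewrite H; ring.
Qed.

Lemma Cmod_sign (sigma : R) : sigma * sigma = 1 -> Cmod (0, sigma) = 1.
Proof.
intros H; unfold Cmod; simpl.
replace (_ + _) with 1 by lra; apply sqrt_1.
Qed.

(** On the imaginary axis the factor [exp (e^w)] has modulus at most [e], and the
    Gaussian factor is below a simple exponential once [s - sigma * Im b >= 1],
    because a number that is at least 1 is at most its square. *)
Lemma vertical_value_rate (a B : R) (b : C) (G : C -> C) (sigma : R) :
  0 < a -> Rabs (Re b) <= B -> has_Cderivative G (Phi a b) -> sigma * sigma = 1 ->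
  is_Clim (fun s => G (0, sigma * s)) (vertical_value G sigma) /\
  forall s, sigma * Im b + 1 <= s ->
  Cmod (vertical_value G sigma - G (0, sigma * s)) <=
  tail_const a B / a * exp (- (a * (s - sigma * Im b))).
Proof.
intros Ha Hb DG Hs.
set (K := tail_const a B); set (d := sigma * Im b).
assert (HK : 0 < K / a) by (apply Rdiv_lt_0_compat; [apply exp_pos|exact Ha]).
apply (Clim_of_Cauchy_rate (fun s => G (0, sigma * s))).
2: now apply is_lim_exp_affine.
intros s t Hst.
apply Rle_trans with (- (K / a) * exp (- (a * (t - d))) - - (K / a) * exp (- (a * (s - d)))).
- apply (mean_value_inequality (fun s => G (0, sigma * s))
    (fun s => Phi a b (0%R, sigma * s)%R * (0%R, sigma))%C
    (fun s => - (K / a) * exp (- (a * (s - d)))) (fun s => K * exp (- (a * (s - d))))); [lra| | |].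
  + intros u _; apply (DG (fun u => (0, sigma * u))); split.
    * apply (is_derive_const 0 u).
    * unfold Im; simpl; auto_derive; [trivial|ring].
  + intros u _; auto_derive; [trivial|unfold Rminus; field; lra].
  + intros u Hu; rewrite Cmod_mult, Cmod_sign, Rmult_1_r by exact Hs.
    apply Rle_trans with (1 := Cmod_Phi_imaginary a B b _ Ha Hb).
    apply Rmult_le_compat_l; [apply Rlt_le, exp_pos|]; apply exp_le.
    rewrite (sqr_sign _ _ _ Hs); fold d.
    apply Ropp_le_contravar, Rmult_le_compat_l; [lra|].
    rewrite <- (Rmult_1_r (u - d)) at 1; apply Rmult_le_compat_l; lra.
- assert (0 <= (K / a) * exp (- (a * (t - d))))
    by (apply Rmult_le_pos; [lra|apply Rlt_le, exp_pos]); lra.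
Qed.

(** The two limits of [G] are compared at the corner [(0, sigma * s)] of the
    contour made of a ray and the imaginary axis. *)
Lemma end_value_near_vertical (a B : R) (b : C) (G : C -> C) (sigma s : R) :
  0 < a -> Rabs (Re b) <= B -> has_Cderivative G (Phi a b) -> sigma * sigma = 1 ->
  cos (sigma * s) = -1 -> sigma * Im b + 1 <= s ->
  Cmod (end_value G (sigma * s) - vertical_value G sigma) <=
  (ray_const a B + tail_const a B / a) * exp (- (a * (s - sigma * Im b))).
Proof.
intros Ha Hb DG Hs Hc Hge.
assert (H1 := end_value_rate a B b G (sigma * s) Ha Hb DG Hc 0 (Rle_refl 0)).
assert (H2 := proj2 (vertical_value_rate a B b G sigma Ha Hb DG Hs) s Hge).
replace (end_value G (sigma * s) - vertical_value G sigma)%C with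
  ((end_value G (sigma * s) - G (0%R, (sigma * s)%R)) +
   - (vertical_value G sigma - G (0%R, (sigma * s)%R)))%C by ring.
eapply Rle_trans; [apply Cmod_triangle|]; rewrite Cmod_opp.
rewrite Rmult_plus_distr_r; apply Rplus_le_compat; [|exact H2].
apply Rle_trans with (1 := H1); rewrite Ropp_0, exp_0, Rmult_1_r.
apply Rmult_le_compat_l; [apply Rlt_le, exp_pos|]; apply exp_le.
rewrite (sqr_sign _ _ _ Hs).
apply Ropp_le_contravar, Rmult_le_compat_l; [lra|].
rewrite <- (Rmult_1_r (s - _)) at 1; apply Rmult_le_compat_l; lra.
Qed.

(** * The Gaussian integral *)

Definition erf_int (y : R) : R := RInt (fun t => exp (- (t * t))) 0 y.

Lemma is_derive_erf_int (y : R) : is_derive erf_int y (exp (- (y * y))).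
Proof.
apply (is_derive_RInt_upper (fun t => exp (- (t * t)))); intros s.
apply (ex_derive_continuous (fun t => exp (- (t * t)))); auto_derive; trivial.
Qed.

(** The classical partner of [erf_int]: the square of [erf_int x] plus
    [erf_companion x] does not depend on [x]. *)
Definition erf_companion (x : R) : R :=
  RInt (fun t => exp (- (x * x * (1 + t * t))) / (1 + t * t)) 0 1.

Lemma one_plus_sqr_pos (t : R) : 0 < 1 + t * t.
Proof. assert (H := Rle_0_sqr t); unfold Rsqr in H; lra. Qed.

Lemma is_derive_erf_integrand (x t : R) :
  is_derive (fun x => exp (- (x * x * (1 + t * t))) / (1 + t * t)) x
    (- 2 * (x * exp (- (x * x * (1 + t * t))))).
Proof.
assert (P := one_plus_sqr_pos t); auto_derive; [lra|field; lra].
Qed.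

Lemma ex_RInt_erf_integrand (x a b : R) :
  ex_RInt (fun t => exp (- (x * x * (1 + t * t))) / (1 + t * t)) a b.
Proof.
apply (ex_RInt_continuous (V := R_CompleteNormedModule)); intros t _.
apply (ex_derive_continuous (fun t => exp (- (x * x * (1 + t * t))) / (1 + t * t))).
assert (P := one_plus_sqr_pos t); auto_derive; lra.
Qed.

(** Differentiation under the integral sign produces
    [- 2 x exp (- x^2) exp (- (x t)^2)], and the substitution [x t] turns the
    integral over [t] into [erf_int x]. *)
Lemma is_derive_erf_companion (x : R) :
  is_derive erf_companion x (- 2 * (exp (- (x * x)) * erf_int x)).
Proof.
assert (D : forall x t, Derive (fun u => exp (- (u * u * (1 + t * t))) / (1 + t * t)) x =
                        - 2 * (x * exp (- (x * x * (1 + t * t)))))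
  by (intros; apply is_derive_unique, is_derive_erf_integrand).
eapply is_derive_eq.
- apply (is_derive_RInt_param (fun x t => exp (- (x * x * (1 + t * t))) / (1 + t * t)) 0 1 x).
  + apply filter_forall; intros y t _; eexists; apply is_derive_erf_integrand.
  + intros t _.
    apply continuity_2d_pt_ext with (fun u v => - 2 * (u * exp (- (u * u * (1 + v * v))))).
    * intros u v; now rewrite D.
    * apply continuity_2d_pt_mult; [apply continuity_2d_pt_const|].
      apply continuity_2d_pt_mult; [apply continuity_2d_pt_id1|].
      apply (continuity_1d_2d_pt_comp exp).
      -- apply derivable_continuous_pt, derivable_pt_exp.
      -- apply continuity_2d_pt_opp, continuity_2d_pt_mult;
           [apply continuity_2d_pt_mult; apply continuity_2d_pt_id1|].
         apply continuity_2d_pt_plus; [apply continuity_2d_pt_const|].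
         apply continuity_2d_pt_mult; apply continuity_2d_pt_id2.
  + apply filter_forall; intros y; apply ex_RInt_erf_integrand.
- assert (C : forall u, continuous (fun t => exp (- (t * t))) u).
  { intros u; apply (ex_derive_continuous (fun t => exp (- (t * t)))); auto_derive; trivial. }
  assert (S := RInt_comp_lin (V := R_CompleteNormedModule) (fun t => exp (- (t * t))) x 0 0 1).
  rewrite Rmult_0_r, Rmult_1_r, !Rplus_0_r in S.
  unfold erf_int; rewrite <- S.
  2:{ apply (ex_RInt_continuous (V := R_CompleteNormedModule)); intros; apply C. }
  transitivity (scal (- 2 * exp (- (x * x))) (RInt (fun y => scal x (exp (- ((x * y + 0) * (x * y + 0))))) 0 1)).
  + rewrite <- (RInt_scal (V := R_CompleteNormedModule)).
    * apply RInt_ext; intros t _; rewrite D; unfold scal; simpl; unfold mult; simpl.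
      replace (- (x * x * (1 + t * t))) with (- (x * x) + - ((x * t + 0) * (x * t + 0))) by ring.
      rewrite exp_plus; ring.
    * apply (ex_RInt_continuous (V := R_CompleteNormedModule)); intros t _.
      apply (ex_derive_continuous (fun y => scal x (exp (- ((x * y + 0) * (x * y + 0)))))).
      unfold scal; simpl; unfold mult; simpl; auto_derive; trivial.
  + exact (Rmult_assoc _ _ _).
Qed.

Lemma constant_of_derivative_0 (f : R -> R) (a b : R) :
  (forall s, is_derive f s 0) -> f a = f b.
Proof.
intros H.
assert (M : forall a b, a <= b -> f a = f b).
{ intros u v Huv; apply Rle_antisym.
  - apply (nondecreasing_of_derivative f (fun _ => 0)); trivial; intros; lra.
  - apply Ropp_le_cancel.
    apply (nondecreasing_of_derivative (fun s => - f s) (fun _ => 0)); trivial; [|intros; lra].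
    intros s _; replace 0 with (- 0) by ring.
    now apply (is_derive_opp (V := R_NormedModule)). }
destruct (Rle_dec a b); [now apply M|symmetry; apply M; lra].
Qed.

(** At [x = 0] the companion is the integral of [1 / (1 + t^2)] from 0 to 1. *)
Lemma erf_int_sqr (x : R) : erf_int x * erf_int x = PI / 4 - erf_companion x.
Proof.
enough (E : erf_int x * erf_int x + erf_companion x = PI / 4) by lra.
rewrite (constant_of_derivative_0
  (fun x => erf_int x * erf_int x + erf_companion x) x 0).
- unfold erf_int, erf_companion; rewrite RInt_point.
  rewrite (RInt_ext _ (fun t => / (1 + Rsqr t))).
  + rewrite (is_RInt_unique _ _ _ (minus (atan 1) (atan 0))).
    * rewrite atan_0, atan_1; unfold minus, plus, opp, zero; simpl; ring.
    * apply (is_RInt_derive (V := R_CompleteNormedModule)); intros t _; [apply is_derive_atan|].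
      apply (ex_derive_continuous (fun t => / (1 + Rsqr t))).
      assert (P := one_plus_sqr_pos t); unfold Rsqr; auto_derive; lra.
  + intros t _; assert (P := one_plus_sqr_pos t).
    rewrite !Rmult_0_l, Ropp_0, exp_0; exact (Rmult_1_l _).
- intros s; eapply is_derive_eq.
  + apply (is_derive_plus (V := R_NormedModule)); [|apply is_derive_erf_companion].
    apply (is_derive_mult (K := R_AbsRing)); [apply is_derive_erf_int| |exact Rmult_comm].
    apply is_derive_erf_int.
  + unfold plus, mult; simpl; ring.
Qed.

Lemma erf_companion_bounds (x : R) : 0 <= erf_companion x <= exp (- (x * x)).
Proof.
assert (Q := Rle_0_sqr x); unfold Rsqr in Q.
split.
- apply RInt_ge_0; [lra|apply ex_RInt_erf_integrand|]; intros t _.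
  apply Rlt_le, Rdiv_lt_0_compat; [apply exp_pos|apply one_plus_sqr_pos].
- replace (exp (- (x * x))) with (RInt (fun _ => exp (- (x * x))) 0 1).
  + apply RInt_le; [lra|apply ex_RInt_erf_integrand|apply ex_RInt_const|]; intros t _.
    assert (P := one_plus_sqr_pos t); assert (Q' := Rle_0_sqr t); unfold Rsqr in Q'.
    assert (QQ := Rmult_le_pos _ _ Q Q').
    apply Rle_div_l; [lra|].
    apply Rle_trans with (exp (- (x * x)) * 1); [|apply Rmult_le_compat_l; [apply Rlt_le, exp_pos|lra]].
    rewrite Rmult_1_r; apply exp_le; lra.
  + rewrite RInt_const; unfold scal; simpl; unfold mult; simpl; ring.
Qed.

Lemma erf_int_limit : is_lim erf_int p_infty (sqrt PI / 2).
Proof.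
assert (P := PI_RGT_0).
replace (sqrt PI / 2) with (sqrt (PI / 4)).
2:{ rewrite sqrt_div_alt by lra; f_equal.
    replace 4 with (2 * 2) by ring; apply sqrt_square; lra. }
assert (Pos : forall x, 0 <= x -> 0 <= erf_int x).
{ intros x Hx; apply RInt_ge_0; [exact Hx| |intros; apply Rlt_le, exp_pos].
  apply (ex_RInt_continuous (V := R_CompleteNormedModule)); intros t _.
  apply (ex_derive_continuous (fun t => exp (- (t * t)))); auto_derive; trivial. }
apply (is_lim_ext_loc (fun x => sqrt (PI / 4 - erf_companion x))).
{ exists 0; intros x Hx; rewrite <- erf_int_sqr; apply sqrt_square, Pos; lra. }
apply (is_lim_comp_continuous (fun x => PI / 4 - erf_companion x) sqrt).
2: apply continuous_sqrt.
replace (Finite (PI / 4)) with (Finite (PI / 4 - 0)) by (now rewrite Rminus_0_r).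
apply is_lim_minus'; [apply is_lim_const|].
apply (is_lim_le_le_loc (fun _ => 0) (fun x => 1 * exp (- x))).
- exists 1; intros x Hx; destruct (erf_companion_bounds x) as [B1 B2]; split; [exact B1|].
  apply Rle_trans with (1 := B2); rewrite Rmult_1_l; apply exp_le.
  assert (1 * x <= x * x) by (apply Rmult_le_compat_r; lra); lra.
- apply is_lim_const.
- apply is_lim_scal_exp_neg.
Qed.

Definition gauss_antiderivative (a : R) : C -> C := primitive (gauss a (RtoC 0)).

(** The integral of [exp (- a t^2)] over the positive half-line. *)
Definition half_gauss (a : R) : R := sqrt PI / 2 / sqrt a.

Lemma erf_int_odd (x : R) : erf_int (- x) = - erf_int x.
Proof.
enough (E : erf_int x + erf_int (- x) = 0) by lra.
rewrite (constant_of_derivative_0 (fun x => erf_int x + erf_int (- x)) x 0).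
- rewrite Ropp_0; unfold erf_int; rewrite RInt_point; unfold zero; simpl; ring.
- intros s; apply is_derive_eq with (exp (- (s * s)) + -1 * exp (- (- s * - s))).
  + apply (is_derive_plus (V := R_NormedModule)); [apply is_derive_erf_int|].
    apply (is_derive_comp erf_int Ropp s); [apply is_derive_erf_int|].
    auto_derive; trivial.
  + replace (- s * - s) with (s * s) by ring; ring.
Qed.

(** On the imaginary axis [exp (a w^2) dw = i exp (- a s^2) ds]. *)
Lemma gauss_antiderivative_axis (a s : R) : 0 < a ->
  gauss_antiderivative a (0, s) =
  (gauss_antiderivative a (0%R, 0%R) + (0%R, (erf_int (sqrt a * s) / sqrt a)%R))%C.
Proof.
intros Ha; set (N := gauss_antiderivative a).
assert (Sa := sqrt_lt_R0 a Ha).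
assert (D : forall u, is_Cderive (fun t => N (0, t)) u (0, exp (- (a * (u * u))))).
{ intros u; eapply is_Cderive_eq.
  - exact (gauss_primitive a (RtoC 0) _ u _ (is_Cderive_vertical 0 u)).
  - unfold gauss, Cexp; apply Ceq; unfold Re, Im; simpl.
    + replace (_ + 0 * _) with 0 by ring; rewrite cos_0, sin_0; ring.
    + replace (a * _ + 0 * _) with 0 by ring; rewrite cos_0, sin_0.
      replace (a * _ - 0 * _) with (- (a * (u * u))) by ring; ring. }
apply Ceq.
- rewrite re_plus; change (Re (N (0, s)) = Re (N (0, 0)) + 0); rewrite Rplus_0_r.
  apply (constant_of_derivative_0 (fun t => Re (N (0, t)))); intros t; apply D.
- rewrite im_plus; change (Im (N (0, s)) = Im (N (0, 0)) + erf_int (sqrt a * s) / sqrt a).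
  enough (E : Im (N (0, s)) - erf_int (sqrt a * s) / sqrt a = Im (N (0, 0))) by lra.
  rewrite (constant_of_derivative_0
    (fun t => Im (N (0, t)) - erf_int (sqrt a * t) / sqrt a) s 0).
  + rewrite Rmult_0_r; unfold erf_int; rewrite RInt_point; unfold zero; simpl; field; lra.
  + intros t.
    apply is_derive_eq with
      (exp (- (a * (t * t))) - sqrt a * exp (- (sqrt a * t * (sqrt a * t))) * / sqrt a).
    * apply (is_derive_minus (V := R_NormedModule)); [apply D|].
      apply (is_derive_scal_l (K := R_AbsRing) (V := R_NormedModule)
               (fun t => erf_int (sqrt a * t))).
      apply (is_derive_comp erf_int (fun t => sqrt a * t)); [apply is_derive_erf_int|].
      auto_derive; [trivial|ring].
    * replace (sqrt a * t * (sqrt a * t)) with (sqrt a * sqrt a * (t * t)) by ring.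
      rewrite sqrt_sqrt by lra; field; lra.
Qed.

Lemma gauss_axis_limit (a sigma : R) : 0 < a -> sigma * sigma = 1 ->
  is_Clim (fun s => gauss_antiderivative a (0, sigma * s))
    (gauss_antiderivative a (0%R, 0%R) + (0%R, (sigma * half_gauss a)%R))%C.
Proof.
intros Ha Hs; assert (Sa := sqrt_lt_R0 a Ha).
apply (is_Clim_ext (fun s => gauss_antiderivative a (0%R, 0%R) +
  (0%R, (sigma * (erf_int (sqrt a * s - 0) / sqrt a))%R))%C).
{ intros s; rewrite (gauss_antiderivative_axis a (sigma * s) Ha); do 2 f_equal.
  rewrite Rminus_0_r.
  assert (S : sigma = 1 \/ sigma = -1).
  { assert (Z : (sigma - 1) * (sigma + 1) = 0) by lra.
    apply Rmult_integral in Z; destruct Z; [left|right]; lra. }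
  destruct S as [-> | ->].
  - replace (sqrt a * (1 * s)) with (sqrt a * s) by ring; ring.
  - replace (sqrt a * (-1 * s)) with (- (sqrt a * s)) by ring.
    rewrite erf_int_odd; field; lra. }
apply is_Clim_plus; split; unfold Re, Im; simpl; try apply is_lim_const.
apply (is_lim_scal_l _ sigma p_infty (Finite (half_gauss a))).
apply (is_lim_scal_r (fun s => erf_int (sqrt a * s - 0)) (/ sqrt a) p_infty (Finite (sqrt PI / 2))).
apply is_lim_comp_affine; [exact Sa|apply erf_int_limit].
Qed.

(** Shift of the line of integration: the horizontal segment that joins the line
    [Re w = - Re b] to the imaginary axis contributes at most a constant times
    [exp (- a s^2)]. *)
Lemma gauss_vertical_limit (a sigma : R) (b : C) : 0 < a -> sigma * sigma = 1 ->
  is_Clim (fun s => gauss_antiderivative a ((0%R, (sigma * s)%R) - b)%C)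
    (gauss_antiderivative a (0%R, 0%R) + (0%R, (sigma * half_gauss a)%R))%C.
Proof.
intros Ha Hs; set (N := gauss_antiderivative a); set (l := (N _ + _)%C).
assert (L : is_Clim (fun s => N (- Re b, sigma * s)) l).
{ apply (is_Clim_ext (fun s => N (0%R, (sigma * s)%R) + (N (- Re b, sigma * s)%R - N (0%R, (sigma * s)%R)))%C);
    [intros; ring|].
  replace l with (l + 0)%C by ring.
  apply is_Clim_plus; [now apply gauss_axis_limit|].
  set (D := Rabs (Re b) * exp (a * (Re b * Re b))).
  apply is_Clim_of_rate with (fun s => D * exp (- (a * (s - 0)))) 1.
  2: now apply is_lim_exp_affine.
  intros s Hs1.
  replace (N (- Re b, sigma * s)%R - N (0%R, (sigma * s)%R) - 0)%C with
    (N (- Re b, sigma * s)%R - N (0%R, (sigma * s)%R))%C by ring.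
  apply Rle_trans with (exp (a * (Re b * Re b)) * exp (- (a * (s - 0))) * Rabs (- Re b - 0)).
  2: { rewrite !Rminus_0_r, Rabs_Ropp; unfold D; right; ring. }
  apply (mean_value_inequality_abs (fun u => N (u, sigma * s))
           (fun u => gauss a (RtoC 0) (u, sigma * s)%R * RtoC 1)%C).
  - apply Rmult_le_pos; apply Rlt_le, exp_pos.
  - intros u; exact (gauss_primitive a (RtoC 0) _ u _ (is_Cderive_horizontal u (sigma * s))).
  - intros u Hu; rewrite Cmult_1_r, Cmod_gauss, <- exp_plus; apply exp_le.
    unfold Re at 1 2, Im at 1 2; simpl; rewrite !Rminus_0_r.
    rewrite Rabs_Ropp, Rabs_R0, Rmax_right in Hu by apply Rabs_pos.
    apply Rsqr_le_abs_1 in Hu; unfold Rsqr in Hu.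
    assert (H1 := Rmult_le_compat_l a _ _ ltac:(lra) Hu).
    replace (sigma * s * (sigma * s)) with (sigma * sigma * (s * s)) by ring.
    rewrite Hs, Rmult_1_l.
    assert (H2 : 1 * s <= s * s) by (apply Rmult_le_compat_r; lra).
    assert (H3 := Rmult_le_compat_l a _ _ ltac:(lra) H2); lra. }
apply (is_Clim_ext (fun s => N (- Re b, sigma * (s - sigma * Im b)))).
- intros s; f_equal; apply Ceq; unfold Re, Im; simpl; [ring|].
  transitivity (sigma * s - sigma * sigma * snd b); [ring|rewrite Hs; ring].
- exact (is_Clim_shift _ _ _ L).
Qed.

(** * The Taylor remainder of the complex exponential *)

Fixpoint exp_remainder (n : nat) (z : C) : C :=
  match n with
  | O => Cexp z
  | S k => (exp_remainder k z - RtoC (/ INR (fact k)) * z ^ k)%C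
  end.

Lemma exp_remainder_sum_n (n : nat) (z : C) :
  exp_remainder (S n) z = (Cexp z - sum_n (fun k => RtoC (/ INR (fact k)) * z ^ k)%C n)%C.
Proof.
induction n as [|n IH]; [now rewrite sum_O|].
rewrite sum_Sn; change (exp_remainder (S (S n)) z) with
  (exp_remainder (S n) z - RtoC (/ INR (fact (S n))) * z ^ S n)%C.
rewrite IH; unfold plus; simpl; ring.
Qed.

Lemma exp_monomial_Cderivative (k : nat) :
  has_Cderivative (fun z => RtoC (/ INR (fact (S k))) * z ^ S k)%C
                  (fun z => RtoC (/ INR (fact k)) * z ^ k)%C.
Proof.
assert (P : forall n, has_Cderivative (fun z => z ^ S n)%C (fun z => RtoC (INR (S n)) * z ^ n)%C).
{ induction n as [|n IH].
  - intros c s l H; apply is_Cderive_ext with c; [intros; simpl; ring|].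
    eapply is_Cderive_eq; [exact H|]; simpl; ring.
  - refine (has_Cderivative_ext _ _ _ _ (has_Cderivative_mult _ _ _ _ has_Cderivative_id IH)).
    intros z; cbv beta; rewrite (S_INR (S n)), RtoC_plus, (Cpow_S z n); ring. }
refine (has_Cderivative_ext _ _ _ _
  (has_Cderivative_mult _ _ _ _ (has_Cderivative_const (RtoC (/ INR (fact (S k))))) (P k))).
intros z; cbv beta.
rewrite Cmult_0_l, Cplus_0_l, Cmult_assoc, <- RtoC_mult; do 2 f_equal.
rewrite fact_simpl, mult_INR.
assert (A := INR_fact_neq_0 k); assert (B := not_0_INR (S k) ltac:(lia)); now field.
Qed.

(** This makes the remainder estimate an induction: each remainder vanishes at 0
    and has the preceding one as derivative. *)
Lemma exp_remainder_Cderivative (n : nat) :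
  has_Cderivative (exp_remainder (S n)) (exp_remainder n).
Proof.
induction n as [|n IH].
- refine (has_Cderivative_ext _ _ _ _
    (has_Cderivative_minus _ _ _ _ has_Cderivative_exp (has_Cderivative_const (RtoC (/ INR (fact 0)) * 1)%C))).
  intros z; simpl; ring.
- exact (has_Cderivative_minus _ _ _ _ IH (exp_monomial_Cderivative n)).
Qed.

Lemma exp_remainder_0 (n : nat) : exp_remainder (S n) (RtoC 0) = RtoC 0.
Proof.
induction n as [|n IH].
- simpl; unfold Cexp; simpl; rewrite exp_0, cos_0, sin_0, Rinv_1.
  apply Ceq; unfold Re, Im; simpl; ring.
- change (exp_remainder (S n) (RtoC 0) - RtoC (/ INR (fact (S n))) * RtoC 0 ^ S n = 0)%C.
  rewrite IH, Cpow_S; ring.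
Qed.

Lemma Cmod_exp_remainder (n : nat) (z : C) :
  Cmod (exp_remainder n z) <= exp (Cmod z) * Cmod z ^ n / INR (fact n).
Proof.
revert z; induction n as [|n IH]; intros z.
- simpl; rewrite Cmod_Cexp; unfold Rdiv; rewrite Rinv_1, !Rmult_1_r.
  apply exp_le; exact (Rle_trans _ _ _ (Rle_abs _) (re_le_Cmod z)).
- set (M := exp (Cmod z) * Cmod z ^ S n).
  assert (A := INR_fact_neq_0 n); assert (B := not_0_INR (S n) ltac:(lia)).
  assert (I := mean_value_inequality
    (fun t => exp_remainder (S n) (RtoC t * z)) (fun t => exp_remainder n (RtoC t * z) * z)%C
    (fun t => M * t ^ S n / INR (fact (S n))) (fun t => M * t ^ n / INR (fact n)) 0 1).
  replace (exp_remainder (S n) z) with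
    (exp_remainder (S n) (RtoC 1 * z) - exp_remainder (S n) (RtoC 0 * z))%C.
  2:{ rewrite Cmult_0_l, Cmult_1_l, exp_remainder_0; ring. }
  eapply Rle_trans; [apply I|].
  + lra.
  + intros t _; apply (exp_remainder_Cderivative n (fun t => RtoC t * z)%C).
    eapply is_Cderive_eq.
    * apply (is_Cderive_mult RtoC (fun _ => z) t (RtoC 1) (RtoC 0));
        [exact (is_Cderive_horizontal t 0)|apply is_Cderive_const].
    * cbv beta; ring.
  + intros t _; rewrite fact_simpl, mult_INR; auto_derive; [trivial|].
    change (pred (S n)) with n; field; now split.
  + intros t Ht; rewrite Cmod_mult.
    assert (E : Cmod (RtoC t * z) = t * Cmod z)
      by (rewrite Cmod_mult, Cmod_R, Rabs_pos_eq by lra; reflexivity).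
    assert (Z := Cmod_ge_0 z).
    apply Rle_trans with (exp (Cmod z) * (t * Cmod z) ^ n / INR (fact n) * Cmod z).
    * apply Rmult_le_compat_r; [exact Z|].
      apply Rle_trans with (1 := IH (RtoC t * z)%C); rewrite E.
      apply Rmult_le_compat_r; [apply Rlt_le, Rinv_0_lt_compat, INR_fact_lt_0|].
      apply Rmult_le_compat_r; [apply pow_le, Rmult_le_pos; lra|].
      apply exp_le; assert (t * Cmod z <= 1 * Cmod z) by (apply Rmult_le_compat_r; lra); lra.
    * right; unfold M; rewrite Rpow_mult_distr; simpl; field; exact A.
  + right; rewrite pow1, pow_i by lia; unfold Rdiv; ring.
Qed.

Lemma Cexp_nat_mul (k : nat) (w : C) : Cexp (RtoC (INR k) * w)%C = (Cexp w ^ k)%C.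
Proof.
induction k as [|k IH].
- simpl INR; rewrite Cmult_0_l; unfold Cexp; simpl; rewrite exp_0, cos_0, sin_0.
  apply Ceq; unfold Re, Im; simpl; ring.
- rewrite S_INR, RtoC_plus, Cmult_plus_distr_r, Cexp_plus, IH, Cmult_1_l, Cpow_S.
  apply Cmult_comm.
Qed.

(** * The integral along the imaginary axis *)

(** The constant left over when the square is completed in [k w + a (w - b)^2];
    it will turn out to be [x^k q^(k (k - 1) / 2)]. *)
Definition gauss_coef (a : R) (b : C) (k : nat) : C :=
  Cexp (RtoC (INR k) * b - RtoC (INR k * INR k / (4 * a)))%C.

Definition gauss_center (a : R) (b : C) (k : nat) : C := (b - RtoC (INR k / (2 * a)))%C.

Lemma gauss_complete_square (a : R) (b w : C) (k : nat) : 0 < a ->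
  (Cexp w ^ k * gauss a b w)%C =
  (gauss_coef a b k * gauss a (RtoC 0) (w - gauss_center a b k))%C.
Proof.
intros Ha; unfold gauss, gauss_coef, gauss_center.
rewrite <- Cexp_nat_mul, <- !Cexp_plus; f_equal.
apply Ceq; unfold Re, Im; simpl; field; lra.
Qed.

(** A primitive, along the imaginary axis, of the error made when [exp (e^w)] is
    replaced by its Taylor polynomial of degree [n] in [e^w]. *)
Definition truncation_error (a : R) (b : C) (G : C -> C) (n : nat) (s : R) : C :=
  (G (0%R, s) - sum_n (fun k => RtoC (/ INR (fact k)) * gauss_coef a b k *
     gauss_antiderivative a ((0%R, s) - gauss_center a b k))%C n)%C.

Lemma is_Cderive_truncation_error (a : R) (b : C) (G : C -> C) (n : nat) (s : R) :
  0 < a -> has_Cderivative G (Phi a b) ->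
  is_Cderive (truncation_error a b G n) s
    (Ci * (exp_remainder (S n) (Cexp (0%R, s)) * gauss a b (0%R, s)))%C.
Proof.
intros Ha DG; eapply is_Cderive_eq.
- apply is_Cderive_minus; [exact (DG _ _ _ (is_Cderive_vertical 0 s))|].
  apply (is_Cderive_sum_n (fun k s => RtoC (/ INR (fact k)) * gauss_coef a b k *
     gauss_antiderivative a ((0%R, s) - gauss_center a b k))%C
     (fun k => Ci * gauss a b (0%R, s) * (RtoC (/ INR (fact k)) * Cexp (0%R, s) ^ k))%C).
  intros k; eapply is_Cderive_eq.
  + apply is_Cderive_scal.
    apply (gauss_primitive a (RtoC 0) (fun s => (0%R, s) - gauss_center a b k)%C).
    apply (is_Cderive_minus (fun s => (0%R, s)) _ s Ci (RtoC 0));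
      [apply is_Cderive_vertical|apply is_Cderive_const].
  + cbv beta.
    transitivity (RtoC (/ INR (fact k)) * Ci *
      (gauss_coef a b k * gauss a (RtoC 0) ((0%R, s) - gauss_center a b k)))%C; [ring|].
    rewrite <- gauss_complete_square by exact Ha; ring.
- rewrite exp_remainder_sum_n.
  assert (E : forall z F, sum_n (fun k => z * F k)%C n = (z * sum_n F n)%C)
    by (intros z F; exact (sum_n_mult_l (K := C_Ring) z F n)).
  rewrite E.
  replace (Phi a b (0%R, s)) with (Cexp (Cexp (0%R, s)) * gauss a b (0%R, s))%C.
  2:{ unfold Phi, gauss; now rewrite Cexp_plus. }
  ring.
Qed.

Definition truncation_bound (a : R) (b : C) (n : nat) : R :=
  exp 1 * exp (a * (Re b * Re b)) * (PI / sqrt a) * / INR (fact (S n)).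

(** On the imaginary axis [|e^w| = 1], so the Taylor remainder is at most
    [e / (n + 1)!].  The Gaussian weight is bounded by [1 / (1 + a t^2)], whose
    antiderivative is an arctangent and hence bounded on the whole line. *)
Lemma truncation_error_bound (a : R) (b : C) (G : C -> C) (n : nat) (s : R) :
  0 < a -> has_Cderivative G (Phi a b) -> 0 <= s ->
  Cmod (truncation_error a b G n s - truncation_error a b G n (- s))
    <= truncation_bound a b n.
Proof.
intros Ha DG Hs; assert (Sa := sqrt_lt_R0 a Ha).
set (M := exp 1 * / INR (fact (S n)) * exp (a * (Re b * Re b))).
assert (HF := INR_fact_lt_0 (S n)).
assert (HM : 0 < M).
{ repeat apply Rmult_lt_0_compat; try apply exp_pos; now apply Rinv_0_lt_compat. }
set (k := fun t => M / sqrt a * atan (sqrt a * (t - Im b))).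
apply Rle_trans with (k s - k (- s)).
- apply (mean_value_inequality _ _ k
    (fun t => M * / (1 + a * ((t - Im b) * (t - Im b)))) (- s) s ltac:(lra)
    (fun t _ => is_Cderive_truncation_error a b G n t Ha DG)).
  + intros t _; unfold k.
    apply is_derive_eq with
      (M / sqrt a * (sqrt a * / (1 + Rsqr (sqrt a * (t - Im b))))).
    * apply (is_derive_scal (fun t => atan (sqrt a * (t - Im b)))).
      apply (is_derive_comp atan (fun t => sqrt a * (t - Im b)));
        [apply is_derive_atan|auto_derive; [trivial|ring]].
    * unfold Rsqr.
      replace (sqrt a * (t - Im b) * (sqrt a * (t - Im b))) with
        (sqrt a * sqrt a * ((t - Im b) * (t - Im b))) by ring.
      rewrite sqrt_sqrt by lra.
      assert (Q := Rmult_le_pos a _ ltac:(lra) (Rle_0_sqr (t - Im b))); unfold Rsqr in Q.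
      field; split; lra.
  + intros t _; rewrite !Cmod_mult, Cmod_Ci, Rmult_1_l, Cmod_gauss.
    set (y := a * ((t - Im b) * (t - Im b))).
    assert (Hy : 0 <= y) by (apply Rmult_le_pos; [lra|apply Rle_0_sqr]).
    assert (R1 := Cmod_exp_remainder (S n) (Cexp (0, t))).
    rewrite Cmod_Cexp in R1; unfold Re at 1 2 in R1; simpl fst in R1.
    rewrite exp_0, pow1, Rmult_1_r in R1.
    replace (a * ((0 - Re b) * (0 - Re b)) - y) with (a * (Re b * Re b) + - y) by ring.
    rewrite exp_plus, exp_Ropp; unfold M.
    rewrite <- Rmult_assoc; apply Rmult_le_compat.
    * apply Rmult_le_pos; [apply Cmod_ge_0|apply Rlt_le, exp_pos].
    * apply Rlt_le, Rinv_0_lt_compat, exp_pos.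
    * apply Rmult_le_compat_r; [apply Rlt_le, exp_pos|exact R1].
    * apply Rinv_le_contravar; [lra|apply exp_ineq1_le].
- unfold k; rewrite <- Rmult_minus_distr_l.
  assert (B1 := atan_bound (sqrt a * (s - Im b))).
  assert (B2 := atan_bound (sqrt a * (- s - Im b))).
  apply Rle_trans with (M / sqrt a * PI).
  + apply Rmult_le_compat_l; [apply Rlt_le, Rdiv_lt_0_compat; trivial|lra].
  + right; unfold M, truncation_bound; field; split; lra.
Qed.

Lemma sum_n_Cmult_r (z : C) (F : nat -> C) (n : nat) :
  sum_n (fun k => F k * z)%C n = (sum_n F n * z)%C.
Proof. exact (sum_n_mult_r (K := C_Ring) z F n). Qed.

(** Let [s] go to infinity in [truncation_error_bound]: each Gaussian term
    contributes the full Gaussian integral, the same for all [k]. *)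
Lemma vertical_value_truncated (a : R) (b : C) (G : C -> C) (n : nat) :
  0 < a -> has_Cderivative G (Phi a b) ->
  Cmod (vertical_value G 1 - vertical_value G (-1) -
    (0%R, (2 * half_gauss a)%R) *
      sum_n (fun k => RtoC (/ INR (fact k)) * gauss_coef a b k)%C n)
  <= truncation_bound a b n.
Proof.
intros Ha DG.
assert (L : forall sigma, sigma * sigma = 1 ->
  is_Clim (fun s => truncation_error a b G n (sigma * s))
    (vertical_value G sigma -
     sum_n (fun k => RtoC (/ INR (fact k)) * gauss_coef a b k)%C n *
     (gauss_antiderivative a (0%R, 0%R) + (0%R, (sigma * half_gauss a)%R)))%C).
{ intros sigma Hs; apply is_Clim_minus.
  - exact (proj1 (vertical_value_rate a (Rabs (Re b)) b G sigma Ha (Rle_refl _) DG Hs)).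
  - rewrite <- sum_n_Cmult_r.
    apply (is_Clim_sum_n (fun k s => RtoC (/ INR (fact k)) * gauss_coef a b k *
      gauss_antiderivative a ((0%R, (sigma * s)%R) - gauss_center a b k))%C).
    intros k; apply is_Clim_scal.
    now apply gauss_vertical_limit. }
assert (L' := is_Clim_minus _ _ _ _ (L 1 ltac:(lra)) (L (-1) ltac:(lra))).
match type of L' with is_Clim _ ?l =>
  replace (_ - _)%C with l end.
- apply (is_Clim_le _ _ 0 _ L'); intros s Hs.
  rewrite Rmult_1_l; replace (-1 * s) with (- s) by ring.
  now apply truncation_error_bound.
- replace (0%R, (2 * half_gauss a)%R) with
    ((0%R, (1 * half_gauss a)%R) - (0%R, (-1 * half_gauss a)%R))%C
    by (apply Ceq; unfold Re, Im; simpl; ring).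
  ring.
Qed.

(** The division of [k (k - 1)] by 2 in the natural numbers is exact. *)
Lemma INR_triangular (k : nat) : INR (k * (k - 1) / 2) = INR k * (INR k - 1) / 2.
Proof.
induction k as [|k IH]; [simpl; lra|].
replace (S k * (S k - 1))%nat with (k * (k - 1) + k * 2)%nat by (destruct k; simpl; nia).
rewrite Nat.div_add by lia.
rewrite plus_INR, IH, S_INR; field.
Qed.

Lemma Cexp_llog (X : Clog_surface) : Cexp (llog X) = proj X.
Proof. unfold Cexp, llog, proj; simpl; now rewrite exp_ln by apply lmod_pos. Qed.

(** Since [1 / (4 a) = - (ln q) / 2], the exponent is
    [k log x + (k (k - 1) / 2) ln q]. *)
Lemma gauss_coef_eq (q : R) (X : Clog_surface) (k : nat) : 0 < q < 1 ->
  gauss_coef (- (1 / (2 * ln q))) (llog X - RtoC (ln q / 2)) k =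
  (RtoC (q ^ (k * (k - 1) / 2)) * proj X ^ k)%C.
Proof.
intros Hq.
assert (Hl : ln q < 0) by (rewrite <- ln_1; apply ln_increasing; lra).
rewrite <- Cexp_llog, <- Cexp_nat_mul, <- Rpower_pow by lra.
replace (RtoC (Rpower q (INR (k * (k - 1) / 2)))) with
  (Cexp (RtoC (INR (k * (k - 1) / 2) * ln q))).
2:{ unfold Cexp, Rpower; simpl; rewrite cos_0, sin_0; apply Ceq; unfold Re, Im; simpl; ring. }
rewrite <- Cexp_plus; unfold gauss_coef; f_equal.
rewrite INR_triangular.
apply Ceq; unfold Re, Im; simpl; field; lra.
Qed.

(** With [a = - 1 / (2 ln q)] one has [kappa = 4 PI a]. *)
Lemma half_gauss_normalization (q : R) : 0 < q < 1 ->
  (RtoC (sqrt (kappa q)) / (2 * RtoC PI * Ci) *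
   (0%R, (2 * half_gauss (- (1 / (2 * ln q))))%R))%C = RtoC 1.
Proof.
intros Hq.
assert (Hl : ln q < 0) by (rewrite <- ln_1; apply ln_increasing; lra).
assert (P := PI_RGT_0).
set (a := - (1 / (2 * ln q))).
assert (Ha : 0 < a) by now apply inv_ln_pos.
assert (Sa := sqrt_lt_R0 a Ha).
assert (K : sqrt (kappa q) = 2 * sqrt PI * sqrt a).
{ replace (kappa q) with ((2 * sqrt PI * sqrt a) * (2 * sqrt PI * sqrt a)).
  - apply sqrt_square; repeat apply Rmult_le_pos; try lra; apply sqrt_pos.
  - transitivity (4 * (sqrt PI * sqrt PI) * (sqrt a * sqrt a)); [ring|].
    rewrite !sqrt_sqrt by lra; unfold a, kappa; field; lra. }
replace (0%R, (2 * half_gauss a)%R) with (RtoC (2 * half_gauss a) * Ci)%C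
  by (apply Ceq; unfold Re, Im; simpl; ring).
assert (NP : RtoC PI <> 0) by (intros E; apply RtoC_inj in E; lra).
assert (N2 : RtoC 2 <> 0) by (intros E; apply RtoC_inj in E; lra).
transitivity (RtoC (sqrt (kappa q)) * RtoC (2 * half_gauss a) / (RtoC 2 * RtoC PI))%C.
- field; repeat split; trivial; exact Ci_nz.
- rewrite <- !RtoC_mult, <- RtoC_div by lra; f_equal; rewrite K; unfold half_gauss.
  transitivity ((sqrt PI * sqrt PI) / PI); [field; split; lra|].
  rewrite sqrt_sqrt by lra; field; lra.
Qed.

Lemma sum_n_Re_Im (F : nat -> C) (n : nat) :
  Re (sum_n F n) = sum_n (fun k => Re (F k)) n /\
  Im (sum_n F n) = sum_n (fun k => Im (F k)) n.
Proof.
induction n as [|n [IH1 IH2]]; [now rewrite !sum_O|].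
rewrite !sum_Sn, <- IH1, <- IH2; split; reflexivity.
Qed.

Lemma is_series_f_entire (q : R) (x : C) : 0 < q < 1 ->
  is_series (fun k => Re (f_term q x k)) (Re (f_entire q x)) /\
  is_series (fun k => Im (f_term q x k)) (Im (f_entire q x)).
Proof.
intros Hq.
assert (Le : forall k, Cmod (f_term q x k) <= / INR (fact k) * Cmod x ^ k).
{ intros k; unfold f_term; rewrite Cmod_mult, Cmod_pow, Cmod_R.
  apply Rmult_le_compat_r; [apply pow_le, Cmod_ge_0|].
  assert (F := INR_fact_lt_0 k).
  assert (Q1 := pow_lt q (k * (k - 1) / 2) ltac:(lra)).
  assert (Q2 := pow_incr q 1 (k * (k - 1) / 2) ltac:(lra)); rewrite pow1 in Q2.
  rewrite Rabs_pos_eq by (apply Rlt_le, Rdiv_lt_0_compat; trivial).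
  rewrite <- (Rmult_1_l (/ INR (fact k))); apply Rmult_le_compat_r; trivial.
  now apply Rlt_le, Rinv_0_lt_compat. }
assert (E : ex_series (fun k => / INR (fact k) * Cmod x ^ k)).
{ exists (exp (Cmod x)); apply (is_series_ext (fun k => scal (pow_n (Cmod x) k) (/ INR (fact k)))).
  - intros k; rewrite pow_n_pow; apply Rmult_comm.
  - exact (is_exp_Reals (Cmod x)). }
split.
- apply Series_correct; refine (ex_series_le (V := R_CompleteNormedModule) _ _ _ E).
  intros k; exact (Rle_trans _ _ _ (re_le_Cmod _) (Le k)).
- apply Series_correct; refine (ex_series_le (V := R_CompleteNormedModule) _ _ _ E).
  intros k; exact (Rle_trans _ _ _ (Im_le_Cmod _) (Le k)).
Qed.

Lemma truncation_bound_limit (a : R) (b : C) : is_lim_seq (truncation_bound a b) 0.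
Proof.
replace (Finite 0) with (Rbar_mult (exp 1 * exp (a * (Re b * Re b)) * (PI / sqrt a)) 0)
  by (simpl; now rewrite Rmult_0_r).
apply is_lim_seq_scal_l, (is_lim_seq_incr_1 (fun n => / INR (fact n))).
apply is_lim_seq_Reals; intros eps Heps.
destruct (cv_speed_pow_fact 1 eps Heps) as [N HN]; exists N; intros n Hn.
assert (H := HN n Hn); unfold Rdiv in H; now rewrite pow1, Rmult_1_l in H.
Qed.

(** Both sides are limits of the same partial sums: the truncation error of
    [vertical_value_truncated] tends to 0. *)
Lemma vertical_values_sum (q : R) (X : Clog_surface) (G : C -> C) : 0 < q < 1 ->
  has_Cderivative G (Phi (- (1 / (2 * ln q))) (llog X - RtoC (ln q / 2))) ->
  (RtoC (sqrt (kappa q)) / (2 * RtoC PI * Ci) *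
   (vertical_value G 1 - vertical_value G (-1)))%C = f_entire q (proj X).
Proof.
intros Hq DG.
set (a := - (1 / (2 * ln q))) in *; set (b := (llog X - RtoC (ln q / 2))%C) in *.
assert (Ha : 0 < a) by now apply inv_ln_pos.
set (c := (RtoC (sqrt (kappa q)) / (2 * RtoC PI * Ci))%C).
set (V := (c * (vertical_value G 1 - vertical_value G (-1)))%C).
assert (B : forall n, Cmod (V - sum_n (f_term q (proj X)) n) <= Cmod c * truncation_bound a b n).
{ intros n.
  replace (sum_n (f_term q (proj X)) n) with
    (c * (0%R, (2 * half_gauss a)%R) *
     sum_n (fun k => RtoC (/ INR (fact k)) * gauss_coef a b k)%C n)%C.
  - unfold V; rewrite <- Cmult_assoc.
    match goal with |- Cmod ?z <= _ => replace z with
      (c * (vertical_value G 1 - vertical_value G (-1) - (0%R, (2 * half_gauss a)%R) *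
      sum_n (fun k => RtoC (/ INR (fact k)) * gauss_coef a b k) n))%C by ring end.
    rewrite Cmod_mult; apply Rmult_le_compat_l; [apply Cmod_ge_0|].
    now apply vertical_value_truncated.
  - unfold c, a; rewrite half_gauss_normalization, Cmult_1_l by exact Hq.
    apply sum_n_ext; intros k; unfold b; rewrite gauss_coef_eq by exact Hq.
    unfold f_term, Rdiv; rewrite RtoC_mult.
    match goal with |- ?x = ?y => change (@eq C x y) end; ring. }
assert (L : is_lim_seq (fun n => Cmod c * truncation_bound a b n) 0).
{ replace (Finite 0) with (Rbar_mult (Cmod c) 0) by (simpl; now rewrite Rmult_0_r).
  apply is_lim_seq_scal_l, truncation_bound_limit. }
destruct (is_series_f_entire q (proj X) Hq) as [S1 S2].
assert (U : forall (u : nat -> R) (v l : R), is_lim_seq u l ->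
  (forall n, Rabs (v - u n) <= Cmod c * truncation_bound a b n) -> v = l).
{ intros u v l Hu Hv.
  assert (Z : is_lim_seq (fun n => v - u n) 0).
  { apply is_lim_seq_abs_0.
    apply (is_lim_seq_le_le (fun _ => 0) _ _ _
      (fun n => conj (Rabs_pos _) (Hv n)) (is_lim_seq_const 0) L). }
  assert (Z' := is_lim_seq_minus' _ _ _ _ (is_lim_seq_const v) Hu).
  assert (W := is_lim_seq_unique _ _ Z); rewrite (is_lim_seq_unique _ _ Z') in W.
  injection W; lra. }
apply Ceq.
- apply (U (fun n => sum_n (fun k => Re (f_term q (proj X) k)) n) _ _ S1); intros n.
  rewrite <- (proj1 (sum_n_Re_Im (f_term q (proj X)) n)).
  exact (Rle_trans _ _ _ (re_le_Cmod _) (B n)).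
- apply (U (fun n => sum_n (fun k => Im (f_term q (proj X) k)) n) _ _ S2); intros n.
  rewrite <- (proj2 (sum_n_Re_Im (f_term q (proj X)) n)).
  exact (Rle_trans _ _ _ (Im_le_Cmod _) (B n)).
Qed.

(** * The logarithm along a Hankel contour *)

Lemma cos_sin_period_Z (x : R) (k : Z) :
  cos (x + 2 * IZR k * PI) = cos x /\ sin (x + 2 * IZR k * PI) = sin x.
Proof.
assert (Nat : forall y n, cos (y + 2 * INR n * PI) = cos y /\ sin (y + 2 * INR n * PI) = sin y).
{ intros y n; split; [apply cos_period|apply sin_period]. }
destruct (Z_le_gt_dec 0 k) as [H|H].
- rewrite <- (Z2Nat.id k H), <- INR_IZR_INZ; apply Nat.
- assert (E : k = (- Z.of_nat (Z.to_nat (- k)))%Z) by lia.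
  rewrite E, opp_IZR, <- INR_IZR_INZ; set (n := Z.to_nat (- k)).
  destruct (Nat (x + 2 * - INR n * PI) n) as [H1 H2].
  rewrite <- H1, <- H2.
  replace (x + 2 * - INR n * PI + 2 * INR n * PI) with x by ring; now split.
Qed.

Definition odd_pi (j : Z) : R := PI + 2 * IZR j * PI.

Lemma cos_odd_pi (j : Z) : cos (odd_pi j) = -1.
Proof. unfold odd_pi; rewrite (proj1 (cos_sin_period_Z PI j)); apply cos_PI. Qed.

Definition log_lift (X : Clog_surface) (n : Z) : C := (ln (lmod X), larg X - 2 * IZR n * PI).

Lemma Cexp_log_lift (X : Clog_surface) (n : Z) : Cexp (log_lift X n) = proj X.
Proof.
destruct (cos_sin_period_Z (larg X) (- n)) as [H1 H2].
rewrite opp_IZR in H1, H2.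
replace (larg X + 2 * - IZR n * PI) with (larg X - 2 * IZR n * PI) in H1, H2 by ring.
unfold Cexp, log_lift, proj; simpl.
now rewrite H1, H2, exp_ln by apply lmod_pos.
Qed.

Lemma is_derive_half_ln_sqr (x y : R -> R) (s : R) :
  ex_derive x s -> ex_derive y s -> 0 < x s * x s + y s * y s ->
  is_derive (fun u => / 2 * ln (x u * x u + y u * y u)) s
    ((Derive x s * x s + Derive y s * y s) * / (x s * x s + y s * y s)).
Proof.
intros E1 E2 P; auto_derive; [tauto|].
change (fun u => x u) with x; change (fun u => y u) with y; field; lra.
Qed.

Lemma is_derive_atan_ratio (x y : R -> R) (s : R) :
  ex_derive x s -> ex_derive y s -> 0 < x s * x s + y s * y s ->
  is_derive (fun u => atan ((x s * y u - y s * x u) / (x s * x u + y s * y u))) s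
    ((Derive y s * x s - Derive x s * y s) * / (x s * x s + y s * y s)).
Proof.
intros E1 E2 P; auto_derive; [repeat split; trivial; lra|].
change (fun u => x u) with x; change (fun u => y u) with y.
replace (x s * y s + - (y s * x s)) with 0 by ring.
unfold Rsqr; field; lra.
Qed.

Definition px (g : R -> Clog_surface) (s : R) : R := Re (proj (g s)).
Definition py (g : R -> Clog_surface) (s : R) : R := Im (proj (g s)).

Definition log_speed (g : R -> Clog_surface) (s : R) : C := (Derive_RC (fun u => proj (g u)) s / proj (g s))%C.

Lemma proj_sqr (X : Clog_surface) :
  Re (proj X) * Re (proj X) + Im (proj X) * Im (proj X) = lmod X * lmod X.
Proof.
unfold proj, Re, Im; simpl.
assert (H := sin2_cos2 (larg X)); unfold Rsqr in H.
transitivity (lmod X * lmod X * (sin (larg X) * sin (larg X) + cos (larg X) * cos (larg X)));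
  [ring|rewrite H; ring].
Qed.

Lemma log_speed_eq (g : R -> Clog_surface) (s : R) :
  log_speed g s =
  ((Derive (px g) s * px g s + Derive (py g) s * py g s) * / (px g s * px g s + py g s * py g s),
   (Derive (py g) s * px g s - Derive (px g) s * py g s) * / (px g s * px g s + py g s * py g s)).
Proof.
assert (P := proj_sqr (g s)); assert (Q := Rmult_lt_0_compat _ _ (lmod_pos (g s)) (lmod_pos (g s))).
rewrite <- P in Q.
unfold log_speed, Derive_RC, Cdiv, Cinv, Cmult.
unfold px, py in *; unfold Re, Im in *; simpl.
apply Ceq; unfold Re, Im; simpl; field; exact (Rgt_not_eq _ _ Q).
Qed.

Lemma is_derive_ln_lmod (g : R -> Clog_surface) (hg : Hankel_contour g) (s : R) :
  is_derive (fun u => ln (lmod (g u))) s (Re (log_speed g s)).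
Proof.
rewrite log_speed_eq; unfold Re at 1; simpl.
assert (P : px g s * px g s + py g s * py g s = lmod (g s) * lmod (g s)) by apply proj_sqr.
assert (Q := Rmult_lt_0_compat _ _ (lmod_pos (g s)) (lmod_pos (g s))).
apply (is_derive_ext (fun u => / 2 * ln (px g u * px g u + py g u * py g u))).
{ intros u; unfold px, py; rewrite proj_sqr, ln_mult by apply lmod_pos; simpl; field. }
apply is_derive_half_ln_sqr; [apply (hankel_derivable_Re g hg)|apply (hankel_derivable_Im g hg)|now rewrite P].
Qed.

(** The contour only comes with a continuous argument.  Near a given point its
    increment stays below [PI / 2] by continuity, and is then the arctangent of a
    ratio of coordinates; so the argument is as smooth as the contour. *)
Lemma is_derive_larg (g : R -> Clog_surface) (hg : Hankel_contour g) (s : R) :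
  is_derive (fun u => larg (g u)) s (Im (log_speed g s)).
Proof.
rewrite log_speed_eq; unfold Im at 1; simpl.
assert (P : px g s * px g s + py g s * py g s = lmod (g s) * lmod (g s)) by apply proj_sqr.
assert (Q := Rmult_lt_0_compat _ _ (lmod_pos (g s)) (lmod_pos (g s))).
apply (is_derive_ext_loc (fun u => larg (g s) +
         atan ((px g s * py g u - py g s * px g u) / (px g s * px g u + py g s * py g u)))).
- assert (PP := PI2_RGT_0).
  assert (L := proj1 (filterlim_locally _ _) (hankel_arg_continuous g hg s) (mkposreal _ PP)).
  revert L; apply filter_imp; intros u Hu.
  assert (Hu' : Rabs (larg (g u) - larg (g s)) < PI / 2) by exact Hu.
  apply Rabs_lt_between in Hu'.
  replace ((px g s * py g u - py g s * px g u) / (px g s * px g u + py g s * py g u)) with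
    (tan (larg (g u) - larg (g s))).
  + rewrite atan_tan by lra; simpl; ring.
  + assert (C := cos_gt_0 (larg (g u) - larg (g s)) ltac:(lra) ltac:(lra)).
    unfold tan; rewrite cos_minus in *; rewrite sin_minus.
    unfold px, py, proj, Re, Im; simpl; field.
    assert (Ru := lmod_pos (g u)); assert (Rs := lmod_pos (g s)).
    split; [|lra].
    replace (_ + _) with (lmod (g u) * lmod (g s) *
      (cos (larg (g u)) * cos (larg (g s)) + sin (larg (g u)) * sin (larg (g s)))) by ring.
    apply Rgt_not_eq; repeat apply Rmult_lt_0_compat; trivial.
- apply is_derive_eq with (0 + (Derive (py g) s * px g s - Derive (px g) s * py g s) *
    / (px g s * px g s + py g s * py g s)); [|apply Rplus_0_l].
  apply (is_derive_plus (V := R_NormedModule) (fun _ => larg (g s))).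
  + apply (is_derive_const (V := R_NormedModule)).
  + apply is_derive_atan_ratio; [apply (hankel_derivable_Re g hg)|apply (hankel_derivable_Im g hg)|now rewrite P].
Qed.

Lemma is_Cderive_log_lift (g : R -> Clog_surface) (hg : Hankel_contour g) (n : Z) (s : R) :
  is_Cderive (fun u => log_lift (g u) n) s (log_speed g s).
Proof.
split.
- now apply is_derive_ln_lmod.
- apply is_derive_eq with (Im (log_speed g s) - 0); [|ring].
  apply (is_derive_minus (V := R_NormedModule)); [now apply is_derive_larg|].
  apply (is_derive_const (V := R_NormedModule)).
Qed.

Lemma continuous_log_speed (g : R -> Clog_surface) (hg : Hankel_contour g) (s : R) :
  continuous (fun u => Re (log_speed g u)) s /\ continuous (fun u => Im (log_speed g u)) s.
Proof.
assert (C1 : continuous (px g) s) by (apply (ex_derive_continuous (px g)), (hankel_derivable_Re g hg)).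
assert (C2 : continuous (py g) s) by (apply (ex_derive_continuous (py g)), (hankel_derivable_Im g hg)).
assert (C3 : continuous (Derive (px g)) s) by apply (hankel_C1_Re g hg).
assert (C4 : continuous (Derive (py g)) s) by apply (hankel_C1_Im g hg).
assert (CM := fun u v (H : continuous u s) (H' : continuous v s) =>
  continuous_mult (K := R_AbsRing) u v s H H').
assert (C5 : continuous (fun u => / (px g u * px g u + py g u * py g u)) s).
{ apply (continuous_comp (fun u => px g u * px g u + py g u * py g u) Rinv).
  - exact (continuous_plus _ _ _ (CM _ _ C1 C1) (CM _ _ C2 C2)).
  - apply continuous_Rinv.
    unfold px, py; rewrite proj_sqr.
    assert (P := lmod_pos (g s)); apply Rgt_not_eq; now apply Rmult_lt_0_compat. }
split.
- apply (continuous_ext (fun u => (Derive (px g) u * px g u + Derive (py g) u * py g u) *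
    / (px g u * px g u + py g u * py g u))); [intros u; now rewrite log_speed_eq|].
  exact (CM _ _ (continuous_plus _ _ _ (CM _ _ C3 C1) (CM _ _ C4 C2)) C5).
- apply (continuous_ext (fun u => (Derive (py g) u * px g u - Derive (px g) u * py g u) *
    / (px g u * px g u + py g u * py g u))); [intros u; now rewrite log_speed_eq|].
  exact (CM _ _ (continuous_minus _ _ _ (CM _ _ C4 C1) (CM _ _ C3 C2)) C5).
Qed.

(** * The function h and the telescoping sum *)

Lemma is_RInt_Cderive (c c' : R -> C) (a b : R) :
  (forall s, is_Cderive c s (c' s)) ->
  (forall s, continuous (fun u => Re (c' u)) s /\ continuous (fun u => Im (c' u)) s) ->
  is_RInt (V := C_R_NormedModule) c' a b (c b - c a)%C.
Proof.
intros Dc Cc; apply (is_RInt_fct_extend_pair (U := R_NormedModule) (V := R_NormedModule)).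
- apply (is_RInt_derive (V := R_CompleteNormedModule) (fun s => Re (c s)) (fun s => Re (c' s)));
    intros s _; [apply Dc|apply Cc].
- apply (is_RInt_derive (V := R_CompleteNormedModule) (fun s => Im (c s)) (fun s => Im (c' s)));
    intros s _; [apply Dc|apply Cc].
Qed.

(** Both ends of the interval of integration move independently, so only the
    limits of the primitive are needed and no absolute convergence. *)
Lemma is_RInt_gen_Cderive (c c' : R -> C) (la lb : C) :
  (forall s, is_Cderive c s (c' s)) ->
  (forall s, continuous (fun u => Re (c' u)) s /\ continuous (fun u => Im (c' u)) s) ->
  (forall eps, 0 < eps -> Rbar_locally m_infty (fun s => Cmod (c s - la) < eps)) ->
  (forall eps, 0 < eps -> Rbar_locally p_infty (fun s => Cmod (c s - lb) < eps)) ->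
  is_RInt_gen (V := C_R_NormedModule) c' (Rbar_locally m_infty) (Rbar_locally p_infty)
    (lb - la)%C.
Proof.
intros Dc Cc Ha Hb.
apply filterlimi_locally; intros eps.
assert (E : 0 < eps / 2) by (assert (H := cond_pos eps); lra).
apply Filter_prod with (1 := Ha _ E) (2 := Hb _ E).
intros s t Hs Ht; exists (c t - c s)%C; split.
- now apply is_RInt_Cderive.
- apply C_NormedModule_mixin_compat1.
  change (Cmod (c t - c s - (lb - la)) < eps).
  replace (c t - c s - (lb - la))%C with ((c t - lb) + - (c s - la))%C by ring.
  eapply Rle_lt_trans; [apply Cmod_triangle|]; rewrite Cmod_opp; lra.
Qed.

Lemma is_Cderive_continuous (c : R -> C) (s : R) (l : C) :
  is_Cderive c s l ->
  continuous (fun u => Re (c u)) s /\ continuous (fun u => Im (c u)) s.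
Proof.
intros [H1 H2]; split.
- apply (ex_derive_continuous (fun u => Re (c u))); now exists (Re l).
- apply (ex_derive_continuous (fun u => Im (c u))); now exists (Im l).
Qed.

(** The point [Y] is [X] turned [n] times.  The exponential [e^w] does not see
    turns, so turning [X] forwards is the same as turning the contour backwards. *)
Lemma h_integrand_eq (q : R) (g : R -> Clog_surface) (X Y : Clog_surface) (n : Z) (s : R) :
  0 < q < 1 -> lmod Y = lmod X -> larg Y = larg X + 2 * IZR n * PI ->
  h_integrand q g Y s =
  (Phi (- (1 / (2 * ln q))) (llog X - RtoC (ln q / 2)) (log_lift (g s) n) * log_speed g s)%C.
Proof.
intros Hq E1 E2; unfold h_integrand, log_speed, Phi; rewrite Cexp_log_lift.
unfold Cdiv; rewrite <- Cmult_assoc, (Cmult_comm (/ proj (g s))); f_equal; f_equal.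
rewrite RtoC_opp.
replace (log_ratio q (g s) Y) with (log_lift (g s) n - (llog X - RtoC (ln q / 2)))%C.
- simpl; ring.
- unfold log_ratio, log_lift, llog; rewrite E1, E2.
  apply Ceq; unfold Re, Im; simpl; ring.
Qed.

Lemma hankel_integral (q : R) (g : R -> Clog_surface) (X Y : Clog_surface) (n : Z) (G : C -> C) :
  0 < q < 1 -> Hankel_contour g -> lmod Y = lmod X -> larg Y = larg X + 2 * IZR n * PI ->
  has_Cderivative G (Phi (- (1 / (2 * ln q))) (llog X - RtoC (ln q / 2))) ->
  is_RInt_gen (V := C_R_NormedModule) (h_integrand q g Y)
    (Rbar_locally m_infty) (Rbar_locally p_infty)
    (end_value G (odd_pi (- n)) - end_value G (odd_pi (- n - 1)))%C.
Proof.
intros Hq hg E1 E2 DG.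
assert (Ha := inv_ln_pos q Hq).
set (a := - (1 / (2 * ln q))) in *; set (b := (llog X - RtoC (ln q / 2))%C) in *.
apply (is_RInt_gen_ext (V := C_R_NormedModule)
  (fun s => Phi a b (log_lift (g s) n) * log_speed g s)%C).
{ apply filter_forall; intros ab s _; symmetry; now apply h_integrand_eq. }
assert (Lw := fun s => is_Cderive_log_lift g hg n s).
apply (is_RInt_gen_Cderive (fun s => G (log_lift (g s) n))).
- intros s; exact (DG _ _ _ (Lw s)).
- intros s.
  destruct (is_Cderive_continuous _ _ _ (Phi_Cderivative a b _ _ _ (Lw s))) as [P1 P2].
  destruct (continuous_log_speed g hg s) as [Q1 Q2].
  assert (CM := fun u v (H : continuous u s) (H' : continuous v s) =>
    continuous_mult (K := R_AbsRing) u v s H H').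
  split.
  + exact (continuous_minus _ _ _ (CM _ _ P1 Q1) (CM _ _ P2 Q2)).
  + exact (continuous_plus _ _ _ (CM _ _ P1 Q2) (CM _ _ P2 Q1)).
- intros eps Heps.
  apply (end_value_limit a (Rabs (Re b)) b G (odd_pi (- n - 1)) (Rbar_locally m_infty) _
    (fun s => ln (lmod (g s))) (fun s => larg (g s) - 2 * IZR n * PI)); trivial.
  + apply Rle_refl.
  + apply cos_odd_pi.
  + exact (filterlim_comp _ _ _ _ _ _ _ _ (hankel_mod_start g hg) is_lim_ln_p).
  + replace (odd_pi (- n - 1)) with (- PI - 2 * IZR n * PI)
      by (unfold odd_pi; rewrite minus_IZR, opp_IZR; ring).
    exact (is_lim_minus' _ _ _ _ _ (hankel_arg_start g hg) (is_lim_const _ _)).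
- intros eps Heps.
  apply (end_value_limit a (Rabs (Re b)) b G (odd_pi (- n)) (Rbar_locally p_infty) _
    (fun s => ln (lmod (g s))) (fun s => larg (g s) - 2 * IZR n * PI)); trivial.
  + apply Rle_refl.
  + apply cos_odd_pi.
  + exact (filterlim_comp _ _ _ _ _ _ _ _ (hankel_mod_end g hg) is_lim_ln_p).
  + replace (odd_pi (- n)) with (PI - 2 * IZR n * PI)
      by (unfold odd_pi; rewrite opp_IZR; ring).
    exact (is_lim_minus' _ _ _ _ _ (hankel_arg_end g hg) (is_lim_const _ _)).
Qed.

Lemma h_hankel_turn (q : R) (g : R -> Clog_surface) (X : Clog_surface) (n : Z) (G : C -> C) :
  0 < q < 1 -> Hankel_contour g ->
  has_Cderivative G (Phi (- (1 / (2 * ln q))) (llog X - RtoC (ln q / 2))) ->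
  h_hankel q g (turn n X) =
  (RtoC (sqrt (kappa q)) / (2 * RtoC PI * Ci) *
   (end_value G (odd_pi (- n)) - end_value G (odd_pi (- n - 1))))%C.
Proof.
intros Hq hg DG; unfold h_hankel; f_equal.
apply (is_RInt_gen_unique (V := C_R_CompleteNormedModule)).
now apply (hankel_integral q g X).
Qed.

Lemma sum_n_telescope (c : C) (t : nat -> C) (n : nat) :
  sum_n (fun k => c * (t k - t (S k)))%C n = (c * (t O - t (S n)))%C.
Proof.
induction n as [|n IH]; [now rewrite sum_O|].
rewrite sum_Sn, IH; unfold plus; simpl; ring.
Qed.

Lemma bilateral_partial_sum_h (q : R) (g : R -> Clog_surface) (X : Clog_surface)
    (G : C -> C) (M N : nat) :
  0 < q < 1 -> Hankel_contour g ->
  has_Cderivative G (Phi (- (1 / (2 * ln q))) (llog X - RtoC (ln q / 2))) ->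
  bilateral_partial_sum (fun n => h_hankel q g (turn n X)) M N =
  (RtoC (sqrt (kappa q)) / (2 * RtoC PI * Ci) *
   (end_value G (1 * odd_pi (Z.of_nat M)) - end_value G (-1 * odd_pi (Z.of_nat N))))%C.
Proof.
intros Hq hg DG; unfold bilateral_partial_sum.
set (c := (RtoC (sqrt (kappa q)) / (2 * RtoC PI * Ci))%C).
set (t := fun k : nat => end_value G (odd_pi (Z.of_nat M - Z.of_nat k))).
transitivity (sum_n (fun k => c * (t k - t (S k)))%C (M + N)).
- apply sum_n_ext; intros k; rewrite (h_hankel_turn q g X _ G Hq hg DG).
  fold c; unfold t.
  replace (- (Z.of_nat k - Z.of_nat M))%Z with (Z.of_nat M - Z.of_nat k)%Z by lia.
  replace (Z.of_nat M - Z.of_nat k - 1)%Z with (Z.of_nat M - Z.of_nat (S k))%Z by lia.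
  reflexivity.
- rewrite sum_n_telescope; unfold t.
  replace (1 * odd_pi (Z.of_nat M)) with (odd_pi (Z.of_nat M - Z.of_nat 0))
    by (rewrite Rmult_1_l; f_equal; lia).
  replace (-1 * odd_pi (Z.of_nat N)) with (odd_pi (Z.of_nat M - Z.of_nat (S (M + N)))).
  + reflexivity.
  + replace (Z.of_nat M - Z.of_nat (S (M + N)))%Z with (- Z.of_nat N - 1)%Z by lia.
    unfold odd_pi; rewrite minus_IZR, opp_IZR; ring.
Qed.

Lemma INR_le_odd_pi (M : nat) : INR M <= odd_pi (Z.of_nat M).
Proof.
unfold odd_pi; rewrite <- INR_IZR_INZ.
assert (P := PI2_1); assert (H := pos_INR M).
assert (1 * INR M <= PI * INR M) by (apply Rmult_le_compat_r; lra); lra.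
Qed.

(** Only bounds on [log |x|] and [arg x] enter the rate, so one estimate serves
    both for a single point and for compact sets. *)
Lemma bilateral_series_h_uniform (q : R) (g : R -> Clog_surface) (B A eps : R) :
  0 < q < 1 -> Hankel_contour g -> 0 < eps ->
  exists n0 : nat, forall M N : nat, (n0 <= M)%nat -> (n0 <= N)%nat ->
  forall X : Clog_surface, Rabs (ln (lmod X)) <= B -> Rabs (larg X) <= A ->
  Cmod (bilateral_partial_sum (fun n => h_hankel q g (turn n X)) M N
        - f_entire q (proj X))%C < eps.
Proof.
intros Hq hg Heps.
assert (Hl : ln q < 0) by (rewrite <- ln_1; apply ln_increasing; lra).
set (a := - (1 / (2 * ln q))).
assert (Ha : 0 < a) by now apply inv_ln_pos.
set (c := (RtoC (sqrt (kappa q)) / (2 * RtoC PI * Ci))%C).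
set (B' := B + - ln q / 2).
set (K := ray_const a B' + tail_const a B' / a).
assert (HK : 0 < K).
{ apply Rplus_lt_0_compat; [|apply Rdiv_lt_0_compat; trivial]; apply exp_pos. }
destruct (proj2 (is_lim_spec _ _ (Finite 0)) (is_lim_exp_affine (2 * Cmod c * K) a A Ha)
  (mkposreal eps Heps)) as [S1 HS1].
set (S := Rmax S1 (Rmax 0 (A + 1)) + 1).
assert (L1 := Rmax_l S1 (Rmax 0 (A + 1))); assert (L2 := Rmax_r S1 (Rmax 0 (A + 1))).
assert (L3 := Rmax_l 0 (A + 1)); assert (L4 := Rmax_r 0 (A + 1)).
destruct (nfloor_ex S ltac:(unfold S; lra)) as [n0 [_ Hn0]].
exists (n0 + 1)%nat; intros M N HM HN X HX HA.
set (b := (llog X - RtoC (ln q / 2))%C).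
assert (Hb : Rabs (Re b) <= B').
{ replace (Re b) with (ln (lmod X) + - ln q / 2) by (unfold b, Re; simpl; field).
  eapply Rle_trans; [apply Rabs_triang|]; unfold B'.
  rewrite (Rabs_pos_eq (- ln q / 2)) by lra; lra. }
assert (DG := Phi_primitive a b); set (G := primitive (Phi a b)) in DG.
assert (Im_b : Im b = larg X) by (unfold b, Im; simpl; ring).
rewrite (bilateral_partial_sum_h q g X G M N Hq hg DG).
rewrite <- (vertical_values_sum q X G Hq DG); fold c.
assert (Big : forall n, (n0 + 1 <= n)%nat -> S <= odd_pi (Z.of_nat n)).
{ intros n Hn; apply Rle_trans with (2 := INR_le_odd_pi n).
  apply le_INR in Hn; rewrite plus_INR in Hn; simpl in Hn; lra. }
assert (E : forall sigma n, sigma = 1 \/ sigma = -1 -> (n0 + 1 <= n)%nat ->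
  Cmod (end_value G (sigma * odd_pi (Z.of_nat n)) - vertical_value G sigma) <=
  K * exp (- (a * (S - A)))).
{ intros sigma n Hs Hn; assert (Bn := Big n Hn).
  assert (Hsb : sigma * Im b <= A).
  { rewrite Im_b; apply Rabs_le_between in HA; destruct Hs as [-> | ->]; lra. }
  eapply Rle_trans.
  - apply (end_value_near_vertical a B' b); trivial.
    + destruct Hs as [-> | ->]; ring.
    + destruct Hs as [-> | ->].
      * rewrite Rmult_1_l; apply cos_odd_pi.
      * replace (-1 * odd_pi (Z.of_nat n)) with (- odd_pi (Z.of_nat n)) by ring.
        rewrite cos_neg; apply cos_odd_pi.
    + unfold S in Bn; lra.
  - apply Rmult_le_compat_l; [lra|]; apply exp_le, Ropp_le_contravar.
    apply Rmult_le_compat_l; lra. }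
assert (E1 := E 1 M (or_introl eq_refl) HM).
assert (E2 := E (-1) N (or_intror eq_refl) HN).
match goal with |- Cmod ?z < _ => replace z with
  (c * ((end_value G (1 * odd_pi (Z.of_nat M)) - vertical_value G 1) +
      - (end_value G (-1 * odd_pi (Z.of_nat N)) - vertical_value G (-1))))%C by ring end.
rewrite Cmod_mult.
apply Rle_lt_trans with (Cmod c * (2 * (K * exp (- (a * (S - A)))))).
- apply Rmult_le_compat_l; [apply Cmod_ge_0|].
  eapply Rle_trans; [apply Cmod_triangle|]; rewrite Cmod_opp; lra.
- assert (F := HS1 S ltac:(unfold S; lra)); simpl in F.
  apply Rabs_lt_between in F; lra.
Qed.

(** * Compact sets and the theorem *)

Lemma open_annulus (r1 r2 : R) :
  open (T := C_UniformSpace) (fun x : C => r1 < Cmod x < r2).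
Proof.
intros x [H1 H2].
set (d := Rmin (Cmod x - r1) (r2 - Cmod x) / 2).
assert (D1 := Rmin_l (Cmod x - r1) (r2 - Cmod x)).
assert (D2 := Rmin_r (Cmod x - r1) (r2 - Cmod x)).
assert (Hd : 0 < d) by (apply Rdiv_lt_0_compat; [apply Rmin_glb_lt|]; lra).
exists (mkposreal d Hd); intros y Hy.
assert (Q := C_NormedModule_mixin_compat2 x y (mkposreal d Hd) Hy); simpl in Q.
change (Cmod (y - x) < sqrt 2 * d) in Q.
assert (S2 : sqrt 2 < 2) by (rewrite <- (sqrt_square 2) at 2 by lra; apply sqrt_lt_1; lra).
assert (Q' : Cmod (y - x) < 2 * d) by (assert (H := Rmult_lt_compat_r d _ _ Hd S2); lra).
assert (T : forall z w : C, Cmod w <= Cmod (w - z) + Cmod z).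
{ intros z w; replace w with (w - z + z)%C at 1 by ring; apply Cmod_triangle. }
assert (T1 := T x y); assert (T2 := T y x).
assert (E : forall z w : C, Cmod (w - z) = Cmod (z - w)).
{ intros z w; rewrite <- Cmod_opp; f_equal; ring. }
rewrite (E y x) in T2.
unfold d in Q'; lra.
Qed.

(** The open annuli [e^(- n) < |x| < e^n] exhaust the punctured plane. *)
Lemma compact_ln_Cmod_bounded (K : C -> Prop) :
  compact_set (T := C_UniformSpace) K -> (forall x : C, K x -> x <> RtoC 0) ->
  exists B : R, forall x, K x -> Rabs (ln (Cmod x)) <= B.
Proof.
intros HK H0.
destruct (HK nat (fun n x => exp (- INR n) < Cmod x < exp (INR n))) as [l Hl].
- intros n; apply open_annulus.
- intros x Hx; assert (P := proj1 (Cmod_gt_0 x) (H0 x Hx)).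
  destruct (nfloor_ex (Rabs (ln (Cmod x))) (Rabs_pos _)) as [n [_ Hn]].
  exists (n + 1)%nat; rewrite plus_INR; simpl.
  apply Rabs_lt_between in Hn.
  rewrite <- (exp_ln (Cmod x)) by exact P.
  split; apply exp_increasing; lra.
- exists (INR (list_max l)); intros x Hx.
  assert (P := proj1 (Cmod_gt_0 x) (H0 x Hx)).
  destruct (Hl x Hx) as [n [Hn [B1 B2]]].
  assert (I : INR n <= INR (list_max l)).
  { apply le_INR; assert (F := proj1 (list_max_le l (list_max l)) (le_n _)).
    now apply (proj1 (Forall_forall _ _) F). }
  apply Rabs_le_between.
  apply ln_increasing in B1; [|apply exp_pos].
  apply ln_increasing in B2; [|exact P].
  rewrite ln_exp in B1, B2; lra.
Qed.

Lemma Cmod_proj (X : Clog_surface) : Cmod (proj X) = lmod X.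
Proof.
rewrite <- Cexp_llog, Cmod_Cexp; apply exp_ln, lmod_pos.
Qed.

Theorem theorem7p2 (q : R) (hq : 0 < q < 1)
    (g : R -> Clog_surface) (hg : Hankel_contour g) :
  (* f_entire and h_hankel are well defined *)
  (forall x : C, is_series (V := C_R_NormedModule) (f_term q x) (f_entire q x)) /\
  (forall X : Clog_surface,
     ex_RInt_gen (V := C_R_NormedModule) (h_integrand q g X)
       (Rbar_locally m_infty) (Rbar_locally p_infty)) /\
  (forall x : C, x <> RtoC 0 -> forall X : Clog_surface, proj X = x ->
     is_bilateral_series (fun n : Z => h_hankel q g (turn n X)) (f_entire q x)) /\
  (forall K : C -> Prop, compact_set K -> (forall x : C, K x -> x <> RtoC 0) ->
   forall lift : C -> Clog_surface, argument_choice_on K lift ->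
     bilateral_series_cvg_uniformly_on K
       (fun (n : Z) (x : C) => h_hankel q g (turn n (lift x))) (f_entire q)).
Proof.
split; [|split; [|split]].
- intros x; destruct (is_series_f_entire q x hq) as [S1 S2].
  apply filterlim_locally; intros eps.
  assert (E := filter_and _ _ (proj1 (filterlim_locally _ _) S1 eps)
                              (proj1 (filterlim_locally _ _) S2 eps)).
  revert E; apply filter_imp; intros n [B1 B2].
  destruct (sum_n_Re_Im (f_term q x) n) as [E1 E2].
  split.
  + change (Rabs (Re (sum_n (f_term q x) n) - Re (f_entire q x)) < eps).
    rewrite E1; exact B1.
  + change (Rabs (Im (sum_n (f_term q x) n) - Im (f_entire q x)) < eps).
    rewrite E2; exact B2.
- intros X; eexists.
  apply (hankel_integral q g X X 0 _ hq hg eq_refl ltac:(ring) (Phi_primitive _ _)).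
- intros x _ X <-.
  apply filterlim_locally; intros eps.
  destruct (bilateral_series_h_uniform q g (Rabs (ln (lmod X))) (Rabs (larg X)) eps
    hq hg (cond_pos eps)) as [n0 H].
  apply Filter_prod with (fun M => (n0 <= M)%nat) (fun N => (n0 <= N)%nat);
    [now exists n0|now exists n0|].
  intros M N HM HN; apply C_NormedModule_mixin_compat1.
  exact (H M N HM HN X (Rle_refl _) (Rle_refl _)).
- intros K HK H0 lift [Hlift [A HA]] eps Heps.
  destruct (compact_ln_Cmod_bounded K HK H0) as [B HB].
  destruct (bilateral_series_h_uniform q g B A eps hq hg Heps) as [n0 H].
  exists n0; intros M N HM HN x Hx.
  replace (f_entire q x) with (f_entire q (proj (lift x))) by (now rewrite Hlift).
  apply H; trivial; [|now apply HA].
  rewrite <- Cmod_proj, (Hlift x Hx); now apply HB.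
Qed.
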